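(* Let $a\in\mathbb{T}$ and let $\phi$ be analytic on some open neighbourhood $\Omega\subseteq\mathbb{C}$ of $\overline{\mathbb{D}}\setminus\{a\}$, with $\phi(\mathbb{D})\subseteq\mathbb{D}$. If, for some weight $\psi$, the weighted composition operator $W_{\phi,\psi}$ is similar to an isometry on $H^p(\mathbb{D})$ for some $p$ with $1\le p<\infty$, then $\phi$ is inner.
   Context: $\mathbb{D}$ is the open unit disc, $\mathbb{T}$ the unit circle, and $m$ normalised Lebesgue measure on $\mathbb{T}$. For $1\le p<\infty$, $H^p(\mathbb{D})$ is the space of analytic functions $f$ on $\mathbb{D}$ with $\|f\|^p=\sup_{0<r<1}\int_{\mathbb{T}}|f(rt)|^p\,dm(t)<\infty$. For an analytic map $\phi:\mathbb{D}\to\mathbb{D}$ and an analytic function $\psi$ on $\mathbb{D}$ (the weight), the weighted composition operator is $(W_{\phi,\psi}f)(z)=\psi(z)\,f(\phi(z))$; saying it is similar to an isometry on $H^p(\mathbb{D})$ includes the assertion that it maps $H^p(\mathbb{D})$ boundedly into itself. An isometry is a norm-preserving linear operator, not assumed surjective. A bounded operator $T$ on a Banach space $X$ is similar to an isometry if there are a bounded invertible operator $S$ on $X$ (with bounded inverse) and an isometry $U$ on $X$ such that $T=S^{-1}US$. An analytic map $\phi:\mathbb{D}\to\mathbb{D}$ is inner if its boundary values satisfy $|\phi(z)|=1$ for $m$-almost every $z\in\mathbb{T}$. *)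

(* Defs.v *)
From HB Require Import structures.
From mathcomp Require Import all_boot all_order all_algebra.
From mathcomp Require Import all_classical all_reals all_analysis.
From mathcomp Require Import measurable_realfun complex ring lra.

Set Implicit Arguments.
Unset Strict Implicit.
Unset Printing Implicit Defensive.

Import Order.TTheory GRing.Theory Num.Theory numFieldNormedType.Exports.
Import ComplexField.Normc.

Local Open Scope classical_set_scope.
Local Open Scope ring_scope.

(* The modulus topology on R[i], inherited from its numClosedFieldType
   structure, which the libraries do not attach to the type R[i] itself. *)
HB.instance Definition _ (R : rcfType) :=
  NormedModule.copy R[i] (R[i] : numClosedFieldType)^o.

Section Disc.
Context {R : realType}.
Implicit Types (f : R[i] -> R[i]) (t : R).

Definition disc : set R[i] := [set z | normc z < 1].

Definition expi t : R[i] := (cos t +i* sin t)%C.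

(* Only the values of f near c matter. *)
Definition analytic_at f (c : R[i]) : Prop :=
  exists (a : nat -> R[i]) (r : R), 0 < r /\
    forall z : R[i], normc (z - c) < r ->
      series (fun n => a n * (z - c) ^+ n) @ \oo --> f z.

Definition analytic_on (U : set R[i]) f : Prop :=
  forall c, U c -> analytic_at f c.

(* Normalised Lebesgue measure on the unit circle is carried by the angle
   t in [0, 2 pi]. *)
Definition circle_integral (g : R[i] -> R) : \bar R :=
  ((2 * pi)^-1%:E *
   \int[lebesgue_measure]_(t in `[0%R, (2 * pi)%R]) (g (expi t))%:E)%E.

Definition circle_ae (P : R[i] -> Prop) : Prop :=
  {ae (@lebesgue_measure R), forall t, `[0, 2 * pi]%classic t -> P (expi t)}.

(* Boundary values are radial limits. *)
Definition inner f : Prop :=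
  [/\ analytic_on disc f,
      (forall z, disc z -> disc (f z)) &
      circle_ae (fun w => exists b : R[i],
        (fun r : R => f (r%:C%C * w)) @ 1^'- --> b /\ normc b = 1)].

Definition integral_mean (p : R) f (r : R) : \bar R :=
  circle_integral (fun w => normc (f (r%:C%C * w)) `^ p).

Definition hardy_mean (p : R) f : \bar R :=
  ereal_sup [set integral_mean p f r | r in `]0%R, 1%R[].

End Disc.

(* An analytic function on the disc is represented by its extension by 0, so
   that equality in the Hardy space is Leibniz equality. *)
Definition hardy_pred (R : realType) (p : R) (p1 : 1 <= p) :
    {pred R[i] -> R[i]} :=
  mem [set f | [/\ analytic_on disc f, (forall z, ~ disc z -> f z = 0) &
                   (hardy_mean p f < +oo)%E]].

Section HardyClosed.
Context {R : realType}.
Implicit Types (f g : R[i] -> R[i]) (t : R).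

Lemma normrE_normc (z : R[i]) : `|z| = (normc z)%:C%C.
Proof. by []. Qed.

Lemma half_geometric (n : nat) :
  \sum_(0 <= k < n) (2^-1 : R[i]) ^+ k <= 2.
Proof.
have -> : \sum_(0 <= k < n) (2^-1 : R[i]) ^+ k = 2 - 2 * 2^-1 ^+ n.
  elim: n => [|n IH]; first by rewrite big_nil expr0 mulr1 subrr.
  rewrite big_nat_recr//= IH exprS.
  have -> : 2 * (2^-1 * 2^-1 ^+ n) = 2^-1 ^+ n :> R[i].
    by rewrite mulrA divff ?mul1r.
  by rewrite mulr_natl mulr2n; ring.
by rewrite gerBl mulr_ge0// exprn_ge0// invr_ge0.
Qed.

Lemma analytic_continuous f (c : R[i]) :
  analytic_at f c -> {for c, continuous f}.
Proof.
move=> [a [r [r0 fE]]].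
pose rho : R[i] := (r / 2)%:C%C.
have rho0 : 0 < rho by rewrite /rho ltcR divr_gt0.
have [M M0 aM] : exists2 M : R[i], 0 <= M & forall n, `|a n * rho ^+ n| <= M.
  have /fE : normc (c + rho - c) < r.
    rewrite addrC addKr -ltcR -normrE_normc gtr0_norm// /rho ltcR.
    by rewrite ltr_pdivrMr// ltr_pMr// ltr1n.
  move=> /cvgP/cvg_series_cvg_0/cvgP/cvg_seq_bounded[M [Mreal aM]].
  exists (`|M| + 1) => [|n]; first by rewrite addr_ge0.
  have := aM (`|M| + 1) _ n Logic.I; rewrite [c + _]addrC addrK; apply.
  by rewrite (le_lt_trans (real_ler_norm Mreal))// ltrDl.
have rhor (z : R[i]) : `|z - c| <= rho / 2 -> normc (z - c) < r.
  move=> zc; rewrite -ltcR -normrE_normc (le_lt_trans zc)//.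
  rewrite (@lt_trans _ _ rho)// ?ltr_pdivrMr ?ltr_pMr// ?ltr1n//.
  by rewrite /rho ltcR ltr_pdivrMr// ltr_pMr// ltr1n.
clearbody rho.
pose S (z : R[i]) : nat -> R[i] := series (fun n => a n * (z - c) ^+ n).
have SM (z : R[i]) n : `|z - c| <= rho / 2 ->
    `|S z n - S c n| <= 4 * M / rho * `|z - c|.
  move=> zc; rewrite /S /series/= -sumrB.
  apply: le_trans (ler_norm_sum _ _ _) _.
  have -> : 4 * M / rho * `|z - c| = 2 * M / rho * `|z - c| * 2 by ring.
  apply: (le_trans _ (ler_wpM2l _ (half_geometric n))); last first.
    by rewrite !mulr_ge0// invr_ge0 ltW.
  rewrite mulr_sumr; apply: ler_sum => -[|k] _.
    by rewrite !expr0 subrr normr0 !mulr_ge0// ?invr_ge0 ?ltW// exprn_ge0.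
  rewrite subrr expr0n/= mulr0 subr0.
  have -> : `|a k.+1 * (z - c) ^+ k.+1| =
      `|a k.+1 * rho ^+ k.+1| * (`|z - c| / rho) * (`|z - c| / rho) ^+ k.
    rewrite !normrM !normrX (gtr0_norm rho0) -[RHS]mulrA -exprS expr_div_n.
    by rewrite -[RHS]mulrA [X in _ = _ * X]mulrC divfK// expf_neq0// gt_eqF.
  have -> : 2 * M / rho * `|z - c| * 2^-1 ^+ k.+1 =
      M * (`|z - c| / rho) * 2^-1 ^+ k.
    by rewrite exprS; field; rewrite gt_eqF.

  apply: ler_pM.
  - by rewrite mulr_ge0// divr_ge0// ltW.
  - by rewrite exprn_ge0// divr_ge0// ltW.
  - by rewrite ler_wpM2r// divr_ge0// ltW.
  - apply: lerXn2r; rewrite ?nnegrE ?invr_ge0//.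
      by rewrite divr_ge0// ltW.
    by rewrite ler_pdivrMr// mulrC.
apply/(@cvgrPdist_le _ _ _ (nbhs c)) => e e0.
have K0 : 0 < 4 * M / rho + 1.
  by rewrite ltr_wpDl// divr_ge0// ?mulr_ge0// ltW.
have near1 (d : R[i]) : 0 < d -> \forall z \near c, `|z - c| <= d.
  move=> d0; have /cvgrPdist_le/(_ _ d0) : (fun z : R[i] => z) @ c --> c by [].
  by apply: filterS => z; rewrite distrC.
near=> z.
have zc : `|z - c| <= rho / 2 by near: z; apply: near1; rewrite divr_gt0.
have zK : `|z - c| <= e / 3 / (4 * M / rho + 1).
  by near: z; apply: near1; rewrite !divr_gt0.
have e3 : 0 < e / 3 by rewrite divr_gt0.
have Sz : S z @ \oo --> f z. by apply: fE; exact: rhor.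
have Sc : S c @ \oo --> f c by apply: fE; rewrite subrr normc0.
near \oo => n.
have -> : f c - f z = (f c - S c n) - (S z n - S c n) - (f z - S z n) by ring.
have -> : e = e / 3 + e / 3 + e / 3 by field.
apply: (le_trans (ler_normB _ _)); apply: lerD; last first.
  by near: n; move/cvgrPdist_le : Sz; exact.
apply: (le_trans (ler_normB _ _)); apply: lerD.
  by near: n; move/cvgrPdist_le : Sc; exact.
apply: (le_trans (SM _ _ zc)).
move: zK; rewrite ler_pdivlMr// => zK; apply: le_trans zK.
by rewrite mulrC ler_wpM2l// lerDl.
Unshelve. all: by end_near. Qed.

Lemma expi_norm t : normc (expi t) = 1.
Proof. by rewrite /= cos2Dsin2 sqrtr1. Qed.

Lemma circle_in_disc (r : R) t : r \in `]0%R, 1%R[ -> disc (r%:C%C * expi t).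
Proof.
rewrite in_itv/= => /andP[r0 r1].
by rewrite /disc /mkset normcM expi_norm mulr1 /= expr0n addr0 sqrtr_sqr gtr0_norm.
Qed.

Lemma normc_ge0 (z : R[i]) : 0 <= normc z.
Proof. by case: z => x y /=; rewrite sqrtr_ge0. Qed.

Lemma normc_triangle (x y : R[i]) : normc (x + y) <= normc x + normc y.
Proof. exact: le_normcD. Qed.

Lemma normc_abs_le (x : R[i]) : normc x <= `|complex.Re x| + `|complex.Im x|.
Proof.
case: x => x y /=; rewrite -[leRHS]ger0_norm ?addr_ge0// -sqrtr_sqr.
rewrite ler_wsqrtr// sqrrD !real_normK ?num_real//.
by rewrite addrAC lerDl mulrn_wge0// mulr_ge0.
Qed.

Lemma normc_dist (x y : R[i]) : `|normc x - normc y| <= normc (x - y).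
Proof.
have h (u v : R[i]) : normc u - normc v <= normc (u - v).
  by rewrite lerBlDr -{1}(subrK v u) normc_triangle.
by rewrite ler_norml h andbT lerNl opprB (le_trans (h _ _))// -normcN opprB.
Qed.

Lemma continuous_circle_normc f (r : R) : analytic_on disc f ->
  r \in `]0%R, 1%R[ -> continuous (fun t => normc (f (r%:C%C * expi t))).
Proof.
move=> af r01 t; apply/cvgrPdist_lt => e e0.
have /analytic_continuous/cvgrPdist_lt : analytic_at f (r%:C%C * expi t).
  by apply: af; exact: circle_in_disc.
have e0C : 0 < e%:C%C by rewrite ltcR.
move=> /(_ _ e0C)/nbhs_ballP[d /= d0 df].
have d0R : 0 < complex.Re d by move: d0; rewrite ltcE => /andP[].
have dE : d = (complex.Re d)%:C%C.
  by move: d d0 {df d0R} => [x y]; rewrite ltcE/= => /andP[/eqP-> _].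
have : \forall s \near t, `|cos t - cos s| < complex.Re d / 2.
  by have /cvgrPdist_lt := @continuous_cos R t; apply; rewrite divr_gt0.
have : \forall s \near t, `|sin t - sin s| < complex.Re d / 2.
  by have /cvgrPdist_lt := @continuous_sin R t; apply; rewrite divr_gt0.
apply: filterS2 => s hs hc.
rewrite (le_lt_trans (normc_dist _ _))// -ltcR -normrE_normc; apply: df.
rewrite -ball_normE /ball_/= -mulrBr dE normrE_normc ltcR normcM.
have /andP[r0 r1] : 0 < r < 1 by move: r01; rewrite in_itv.
rewrite [normc r%:C%C]/= expr0n addr0 sqrtr_sqr gtr0_norm//.
apply: (@le_lt_trans _ _ (1 * normc (expi t - expi s))).
  by rewrite ler_wpM2r ?normc_ge0// ltW.
rewrite mul1r (le_lt_trans (normc_abs_le _))//= [ltRHS]splitr.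
exact: ltrD.
Qed.

Let circle : set R := `[0%R, (2 * pi)%R]%classic.
Let hp (p : R) f (r : R) t := normc (f (r%:C%C * expi t)) `^ p.

Lemma measurable_hp p f r : analytic_on disc f ->
  r \in `]0%R, 1%R[ -> measurable_fun circle (EFin \o hp p f r).
Proof.
move=> af r01; apply/measurable_EFinP.
apply: (measurableT_comp (measurable_powR p)).
apply: measurable_funTS.
apply: continuous_measurable_fun; exact: continuous_circle_normc.
Qed.

Lemma hardy_mean_lty p f : (hardy_mean p f < +oo)%E <->
  exists2 M : R, 0 <= M & forall r : R, r \in `]0%R, 1%R[ ->
    (\int[lebesgue_measure]_(t in circle) (hp p f r t)%:E <= M%:E)%E.
Proof.
have pi0 : 0 < 2 * pi :> R by rewrite mulr_gt0// pi_gt0.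
have hle (r : R) (M : R) : 
  (\int[lebesgue_measure]_(t in circle) (hp p f r t)%:E <= (2 * pi * M)%:E)%E <->
  (integral_mean p f r <= M%:E)%E.
  by rewrite /integral_mean /circle_integral EFinM -lee_pdivrMl.
split=> [fin|[M M0 fM]].
  exists (2 * pi * Num.max 0 (fine (hardy_mean p f))).
    by apply: mulr_ge0; [exact: ltW|rewrite le_max lexx].
  move=> r r01; apply/hle.
  have : (integral_mean p f r <= hardy_mean p f)%E.
    by apply: ereal_sup_ubound; exists r.
  move: fin.
  case: (hardy_mean p f) => [x _|//|_]/=.
    by move=> /le_trans; apply; rewrite lee_fin le_max lexx orbT.
  by move=> /le_trans; apply; rewrite leNye.
apply: (@le_lt_trans _ _ ((2 * pi)^-1 * M)%:E); last exact: ltry.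
apply: ge_ereal_sup => _ [r r01 <-]; apply/hle.
by rewrite mulrA divff ?mul1r ?gt_eqF//; exact: fM.
Qed.

Lemma powRD_le (p x y z : R) : 0 <= p -> 0 <= x -> 0 <= y -> z <= x + y ->
  0 <= z -> z `^ p <= 2 `^ p * (x `^ p + y `^ p).
Proof.
move=> p0 x0 y0 zxy z0.
apply: (@le_trans _ _ (2 `^ p * (Num.max x y) `^ p)).
  rewrite -powRM ?le_max ?x0// ge0_ler_powR// ?nnegrE ?mulr_ge0 ?le_max ?x0//.
  apply: (le_trans zxy); rewrite mulr_natl mulr2n lerD// le_max lexx//.
  by rewrite orbT.
rewrite ler_wpM2l ?powR_ge0//.
by case: (leP x y) => _; rewrite ?lerDl ?lerDr powR_ge0.
Qed.

End HardyClosed.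

Lemma hardy_predP (R : realType) (p : R) (p1 : 1 <= p) (f : R[i] -> R[i]) :
  f \in hardy_pred p1 <-> [/\ analytic_on disc f,
    (forall z, ~ disc z -> f z = 0) & (hardy_mean p f < +oo)%E].
Proof. by rewrite inE. Qed.

Lemma hardy_submod_closed (R : realType) (p : R) (p1 : 1 <= p) :
  submod_closed (hardy_pred p1).
Proof.
have p0 : 0 <= p by rewrite (le_trans ler01).
split.
  apply/hardy_predP; split=> //.
    move=> c _; exists (fun=> 0), 1; split=> // z _.
    rewrite (_ : series _ = cst 0); first exact: cvg_cst.
    by apply/funext => n; rewrite /series/= big1// => i _; rewrite mul0r.
  apply/hardy_mean_lty; exists 0 => // r _.
  rewrite integral0_eq// => t _.
  by rewrite normc0 powR0// gt_eqF// (lt_le_trans ltr01).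
move=> k u v /hardy_predP[au u0 uM] /hardy_predP[av v0 vM].
apply/hardy_predP.
have ncge0 := @normc_ge0 R.
have kuvE z : (k *: u + v) z = k * u z + v z by [].
have an : analytic_on disc (k *: u + v).
  move=> c dc; have [a [r [r0 aE]]] := au c dc.
  have [b [s [s0 bE]]] := av c dc.
  exists (fun n => k * a n + b n), (Num.min r s).
  split=> [|z]; rewrite lt_min ?r0// => /andP[/aE az /bE bz].
  have -> : series (fun n => (k * a n + b n) * (z - c) ^+ n) =
      (fun n => k * series (fun n => a n * (z - c) ^+ n) n +
                series (fun n => b n * (z - c) ^+ n) n).
    apply/funext => n; rewrite /series/= mulr_sumr -big_split/=.
    by apply: eq_bigr => i _; rewrite mulrDl mulrA.
  rewrite kuvE.
  apply: cvgD; last exact: bz.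
  by apply: cvgM; [exact: cvg_cst|exact: az].
split; first exact: an.
  by move=> z dz; rewrite kuvE (u0 _ dz) (v0 _ dz) mulr0 addr0.
move/hardy_mean_lty : uM => [M M0 uM]; move/hardy_mean_lty : vM => [N N0 vN].
apply/hardy_mean_lty; exists (2 `^ p * (normc k `^ p * M + N)).
  by rewrite mulr_ge0 ?addr_ge0 ?mulr_ge0 ?powR_ge0.
move=> r r01.
pose U t := (normc (u (r%:C%C * expi t)) `^ p).
pose V t := (normc (v (r%:C%C * expi t)) `^ p).
have mU := measurable_hp p au r01.
have mV := measurable_hp p av r01.
apply: (@le_trans _ _ (\int[lebesgue_measure]_(t in `[0%R, (2 * pi)%R])
   ((2 `^ p)%:E * ((normc k `^ p)%:E * (U t)%:E + (V t)%:E)))%E).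
  apply: ge0_le_integral => //=.
  - by move=> t _; rewrite lee_fin powR_ge0.
  - exact: (measurable_hp p an r01).
  - apply: measurable_funeM; apply: emeasurable_funD => //.
    exact: measurable_funeM.
  - move=> t _; rewrite lee_fin -powRM//.
    rewrite powRD_le// ?mulr_ge0//.
    by rewrite kuvE (le_trans (normc_triangle _ _))// normcM.
have U0 t : (0 <= (U t)%:E)%E by rewrite lee_fin powR_ge0.
have V0 t : (0 <= (V t)%:E)%E by rewrite lee_fin powR_ge0.
have k0 : (0 <= (normc k `^ p)%:E)%E by rewrite lee_fin powR_ge0.
rewrite ge0_integralZl_EFin ?powR_ge0//; first last.
- by apply: emeasurable_funD => //; exact: measurable_funeM.
- by move=> t _; rewrite adde_ge0// mule_ge0.
rewrite EFinM lee_wpmul2l ?lee_fin ?powR_ge0//.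
rewrite ge0_integralD//; first last.
- exact: measurable_funeM.
- by move=> t _; rewrite mule_ge0.
rewrite EFinD EFinM leeD//; last exact: vN.
rewrite ge0_integralZl_EFin ?powR_ge0//.
by rewrite lee_wpmul2l//; exact: uM.
Qed.

Section HardySpace.
Context {R : realType} {p : R}.

Record hardy (p1 : 1 <= p) := Hardy {
  hardy_fun :> R[i] -> R[i];
  hardyP : hardy_fun \in hardy_pred p1 }.

Variable p1 : 1 <= p.

HB.instance Definition _ := GRing.isSubmodClosed.Build _ _
  (hardy_pred p1) (hardy_submod_closed p1).
HB.instance Definition _ := [isSub for @hardy_fun p1].
HB.instance Definition _ := [Choice of hardy p1 by <:].
HB.instance Definition _ := [SubChoice_isSubLmodule of hardy p1 by <:].

Definition hardy_norm (f : hardy p1) : R := fine (hardy_mean p f) `^ p^-1.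

End HardySpace.

Section Operators.
Context {R : realType} {p : R} {p1 : 1 <= p}.
Local Notation H := (hardy p1).
Implicit Types (phi psi : R[i] -> R[i]).

Definition bounded_operator (T : {linear H -> H}) : Prop :=
  exists M : R, forall f, hardy_norm (T f) <= M * hardy_norm f.

Definition isometry (U : {linear H -> H}) : Prop :=
  forall f, hardy_norm (U f) = hardy_norm f.

Definition similar_to_isometry (T : {linear H -> H}) : Prop :=
  bounded_operator T /\
  exists S S' U : {linear H -> H},
    [/\ bounded_operator S, bounded_operator S', cancel S S' & cancel S' S] /\
    isometry U /\ T =1 S' \o U \o S.

Definition weighted_composition phi psi (T : {linear H -> H}) : Prop :=
  forall (f : H) (z : R[i]), disc z -> T f z = psi z * f (phi z).

End Operators.

(* Main.v *)
(* T is bounded below: c = c ||z^k|| <= ||T z^k|| = ||psi phi^k|| for all k, with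
   c > 0.

   On the unit circle minus a, |phi|^2 is real-analytic; hence |phi| = 1 there,
   and phi is inner, or the points with |phi| = 1 are isolated.  In the second
   case psi phi^k tends to 0 in H^p, which contradicts the lower bound.  Away from
   a and finitely many other points of the circle, |phi| is bounded by some q < 1
   near the circle, so it is enough that the measures |psi(r e^it)|^p dt do not
   accumulate at a point b of the circle as r -> 1.  To see this without boundary
   values, multiply psi by G z = (b - z) / ((1 + eta) b - z), which satisfies
   |G| <= 1, vanishes at b and tends to 1 locally uniformly in the disc: since
   integral means increase with the radius, the means of psi G and psi stay close
   for small eta, and their difference controls the mass of |psi|^p near b. *)
Require Import Defs.
From HB Require Import structures.
From mathcomp Require Import all_boot all_order all_algebra.
From mathcomp Require Import all_classical all_reals all_analysis.
From mathcomp Require Import complex.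
From mathcomp Require finmap.
From mathcomp Require Import ring lra.
Import Order.TTheory GRing.Theory Num.Theory numFieldNormedType.Exports.
Import ComplexField.Normc.
Local Open Scope classical_set_scope.
Local Open Scope ring_scope.

Set Implicit Arguments.
Unset Strict Implicit.
Unset Printing Implicit Defensive.

(** * Power series as iterated difference quotients *)

(** Local analysis rests on one notion, [expands]: iterated difference quotients with geometric
    bounds. It can be restricted to any subset of a disc, and this is what makes |phi|^2 tractable:
    conj phi is not analytic in z, but on the circle conj z = 1/z, so conj phi has such an expansion
    on an arc. The leading term of an expansion gives both the isolation of zeros on an arc and the
    absence of strict interior maxima in a disc, with no contour integrals.

    The points with |phi| = 1 may accumulate at a. A neighbourhood of a is therefore removed before
    compactness leaves only finitely many of them, and a is handled as one more point that carries
    no mass, although phi need not have a limit there. Since psi is never evaluated on the circle,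
    every estimate is made on circles of radius r < 1, with constants independent of r. The required
    bound on the means of psi comes from psi = T 1 on the disc. *)

Section Expansion.
Context {R : realType}.
Implicit Types (X Y : set R[i]) (b c z : R[i]) (f g : R[i] -> R[i]).

(* F n is the n-th iterated difference quotient of f at c.  On a disc this is
   analyticity at c, but it also makes sense on an arc of the unit circle. *)
Definition expands X c f := exists (F : nat -> R[i] -> R[i]) (M K : R),
  [/\ 0 <= M, 0 <= K, forall z, X z -> F 0%N z = f z,
    forall n z, X z -> F n z = F n c + (z - c) * F n.+1 z &
    forall n z, X z -> normc (F n z) <= M * K ^+ n].

Lemma normcX z n : normc (z ^+ n) = normc z ^+ n.
Proof. by elim: n => [|n IH]; rewrite ?expr0 ?normc1// !exprS normcM IH. Qed.

Lemma normcB z w : normc (z - w) = normc (w - z).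
Proof. by rewrite -normcN opprB. Qed.

Lemma expands_sub X Y c f : Y `<=` X -> expands X c f -> expands Y c f.
Proof.
move=> YX [F [M [K [M0 K0 F0 FS FM]]]]; exists F, M, K; split=> //.
- by move=> z /YX /F0.
- by move=> n z /YX /FS.
- by move=> n z /YX /FM.
Qed.

Lemma expands_ext X c f g : (forall z, X z -> f z = g z) ->
  expands X c f -> expands X c g.
Proof.
move=> fg [F [M [K [M0 K0 F0 FS FM]]]]; exists F, M, K; split=> // z Xz.
by rewrite F0// fg.
Qed.

Lemma expands_cst X c b : expands X c (fun=> b).
Proof.
exists (fun n _ => if n is 0%N then b else 0), (normc b), 1; split=> //.
- exact: normc_ge0.
- by case=> [|n] z _; rewrite mulr0 addr0.
- by case=> [|n] z _; rewrite expr1n mulr1// normc0 normc_ge0.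
Qed.

Lemma expands_id X c (B : R) : X c -> (forall z, X z -> normc z <= B) ->
  expands X c (fun z => z).
Proof.
move=> Xc XB; have B0 : 0 <= B by apply: le_trans (XB _ Xc); exact: normc_ge0.
exists (fun n z => match n with 0%N => z | 1%N => 1 | _ => 0 end), (B + 1), 1.
split=> //; first by rewrite addr_ge0.
- by move=> [|[|n]] z _; rewrite ?mulr1 ?mulr0 ?addr0 // addrC subrK.
- move=> [|[|n]] z Xz; rewrite expr1n mulr1.
  + by rewrite (le_trans (XB _ Xz))// lerDl.
  + by rewrite normc1 lerDr.
  + by rewrite normc0 addr_ge0.
Qed.

Lemma expandsD X c f g : expands X c f -> expands X c g ->
  expands X c (fun z => f z + g z).
Proof.
move=> [F [M [K [M0 K0 F0 FS FM]]]] [G [N [L [N0 L0 G0 GS GN]]]].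
exists (fun n z => F n z + G n z), (M + N), (K + L).
split; rewrite ?addr_ge0//.
- by move=> z Xz; rewrite F0// G0.
- by move=> n z Xz; rewrite FS// GS//; ring.
- move=> n z Xz; apply: le_trans (normc_triangle _ _) _.
  rewrite mulrDl lerD//.
    by rewrite (le_trans (FM _ _ Xz))// ler_wpM2l// lerXn2r ?nnegrE ?addr_ge0// lerDl.
  by rewrite (le_trans (GN _ _ Xz))// ler_wpM2l// lerXn2r ?nnegrE ?addr_ge0// lerDr.
Qed.

(* The n-th shift of fg is F_n g + sum_(k < n) F_k(c) G_(n - k). *)
Lemma expandsM X c f g : X c -> expands X c f -> expands X c g ->
  expands X c (fun z => f z * g z).
Proof.
move=> Xc [F [M [K [M0 K0 F0 FS FM]]]] [G [N [L [N0 L0 G0 GS GN]]]].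
pose Q := K + L.
have Q0 : 0 <= Q by rewrite addr_ge0.
have KQ n : K ^+ n <= Q ^+ n by rewrite lerXn2r ?nnegrE// lerDl.
have LQ n : L ^+ n <= Q ^+ n by rewrite lerXn2r ?nnegrE// lerDr.
pose H n z := F n z * G 0%N z + \sum_(k < n) F k c * G (n - k)%N z.
exists H, (M * N), (2 * Q); split.
- exact: mulr_ge0.
- by rewrite mulr_ge0.
- by move=> z Xz; rewrite /H big_ord0 addr0 F0// G0.
- move=> n z Xz; rewrite /H big_ord_recr/= subSnn.
  have -> : \sum_(k < n) F k c * G (n - k)%N z =
      \sum_(k < n) F k c * G (n - k)%N c +
      (z - c) * \sum_(k < n) F k c * G (n.+1 - k)%N z.
    rewrite mulr_sumr -big_split/=; apply: eq_bigr => k _.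
    by rewrite subSn; [rewrite (GS _ z Xz); ring|exact: ltnW].
  rewrite {1}(FS _ _ Xz) (GS 0%N z Xz); ring.
- move=> n z Xz; rewrite /H.
  (* Each of the n + 1 summands is at most M N Q^n, and n + 1 <= 2^n accounts for the 2 in the rate
     2 Q. *)
  apply: (@le_trans _ _ (M * N * Q ^+ n * n.+1%:R)).
    apply: le_trans (normc_triangle _ _) _.
    rewrite -addn1 natrD mulrDr mulr1 addrC lerD//.
      apply: (@le_trans _ _ (\sum_(k < n) M * N * Q ^+ n)); last first.
        by rewrite sumr_const card_ord mulr_natr.
      elim/big_ind2 : _ => //; first by rewrite normc0.
        move=> x1 x2 y1 y2 h1 h2; rewrite (le_trans (normc_triangle _ _))//.
        exact: lerD.
      move=> k _; rewrite normcM.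
      have -> : M * N * Q ^+ n = (M * Q ^+ k) * (N * Q ^+ (n - k)).
        by rewrite -{1}(subnKC (ltnW (ltn_ord k))) exprD; ring.
      rewrite ler_pM ?normc_ge0//.
        by rewrite (le_trans (FM _ _ Xc))// ler_wpM2l.
      by rewrite (le_trans (GN _ _ Xz))// ler_wpM2l.
    rewrite normcM [leRHS](_ : _ = (M * Q ^+ n) * N); last by ring.
    rewrite ler_pM ?normc_ge0//.
      by rewrite (le_trans (FM _ _ Xz))// ler_wpM2l.
    by rewrite (le_trans (GN _ _ Xz))// expr0 mulr1.
  rewrite exprMn mulrCA mulrC ler_wpM2r ?mulr_ge0 ?exprn_ge0//.
  by rewrite -natrX ler_nat ltn_expl.
Qed.

Lemma expandsZ X c b f : expands X c f -> expands X c (fun z => b * f z).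
Proof.
move=> [F [M [K [M0 K0 F0 FS FM]]]].
exists (fun n z => b * F n z), (normc b * M), K; split=> //.
- by rewrite mulr_ge0// normc_ge0.
- by move=> z Xz; rewrite F0.
- by move=> n z Xz; rewrite FS//; ring.
- by move=> n z Xz; rewrite normcM -mulrA ler_wpM2l ?normc_ge0// FM.
Qed.

Lemma expandsX X c f n : X c -> expands X c f ->
  expands X c (fun z => f z ^+ n).
Proof.
move=> Xc fX; elim: n => [|n IH]; first exact: expands_cst.
have := expandsM Xc fX IH; by apply: expands_ext => z _; rewrite exprS.
Qed.

(** From 1/(b - z) - 1/(b - c) = (z - c) / ((b - c) (b - z)), the function is its own shift up to
    the factor 1/(b - c). *)
Lemma expands_inv X c b (e : R) : 0 < e -> X c ->
  (forall z, X z -> e <= normc (b - z)) -> expands X c (fun z => (b - z)^-1).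
Proof.
move=> e0 Xc Xe.
have b0 z : X z -> b - z != 0.
  by move=> /Xe; apply: contraTneq => ->; rewrite normc0 -ltNge.
exists (fun n z => (b - z)^-1 * (b - c)^-1 ^+ n), e^-1, e^-1.
split; rewrite ?invr_ge0 ?ltW//.
- by move=> z _; rewrite expr0 mulr1.
- by move=> n z Xz; rewrite exprS; field; rewrite !b0.
- move=> n z Xz; rewrite normcM normcX !normcV.
  have h y : X y -> (normc (b - y))^-1 <= e^-1.
    by move=> Xy; rewrite lef_pV2 ?posrE ?Xe// (lt_le_trans e0)// Xe.
  rewrite ler_pM ?invr_ge0 ?exprn_ge0 ?invr_ge0 ?normc_ge0 ?h//.
  by rewrite lerXn2r ?nnegrE ?invr_ge0 ?normc_ge0 ?h// ltW.
Qed.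

Lemma expands_rot X c b f : expands X (c * b) f ->
  expands [set z | X (z * b)] c (fun z => f (z * b)).
Proof.
move=> [F [M [K [M0 K0 F0 FS FM]]]].
exists (fun n z => F n (z * b) * b ^+ n), M, (K * normc b).
split=> //.
- by rewrite mulr_ge0// normc_ge0.
- by move=> z Xz; rewrite F0// expr0 mulr1.
- by move=> n z Xz; rewrite {1}FS// exprS; ring.
- move=> n z Xz; rewrite normcM normcX exprMn mulrA ler_wpM2r//.
    by rewrite exprn_ge0// normc_ge0.
  exact: FM.
Qed.

End Expansion.

Section Analytic.
Context {R : realType}.
Implicit Types (X : set R[i]) (c z : R[i]) (f g : R[i] -> R[i]).

(** The norm of [R[i]] takes its values in [R[i]], so the epsilons and ball radii of its topology
    are complex numbers; this brings them back to [R]. *)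
Lemma gt0_complexE (e : R[i]) : 0 < e -> 0 < complex.Re e /\ e = (complex.Re e)%:C%C.
Proof.
by case: e => x y; rewrite ltcE/= => /andP[/eqP -> x0].
Qed.

Lemma cvg_normcP (T : Type) (F : set_system T) (FF : Filter F)
    (f : T -> R[i]) (l : R[i]) : f @ F --> l <->
  forall e : R, 0 < e -> \forall x \near F, normc (l - f x) < e.
Proof.
split=> [/cvgrPdist_lt fl e e0|fl].
  have e0C : 0 < e%:C%C :> R[i] by rewrite ltcR.
  by apply: filterS (fl _ e0C) => x; rewrite normrE_normc ltcR.
apply/cvgrPdist_lt => e /gt0_complexE[e0 eE].
by apply: filterS (fl _ e0) => x; rewrite {2}eE normrE_normc ltcR.
Qed.

Lemma geometric_le0 (x M : R) : (forall n, x <= M * 2^-1 ^+ n) -> x <= 0.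
Proof.
move=> xM; rewrite leNgt; apply/negP => x0.
have M0 : 0 < M by have := xM 0%N; rewrite expr0 mulr1; exact: lt_le_trans.
have := xM (Num.bound (M / x)); rewrite exprVn ler_pdivlMr ?exprn_gt0//.
have := archi_boundP (divr_ge0 (ltW M0) (ltW x0)).
rewrite ltr_pdivrMr// => /lt_le_trans h; apply/negP; rewrite -ltNge.
by rewrite mulrC h// ler_wpM2r ?(ltW x0)// -natrX ler_nat ltnW// ltn_expl.
Qed.

Definition cball c (r : R) : set R[i] := [set z | normc (z - c) < r].

Lemma cball_center c (r : R) : 0 < r -> cball c r c.
Proof. by move=> r0; rewrite /cball/= subrr normc0. Qed.

(** Convergence at the single point c + rho bounds |a n| rho^n. For |z - c| < rho / 2 the tail after
    n terms is then dominated by a geometric series of ratio at most 1/2, and the tail divided by (z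
    - c)^n is the n-th difference quotient. *)
Lemma analytic_expands f c : analytic_at f c ->
  exists2 r : R, 0 < r & expands (cball c r) c f.
Proof.
move=> [a [r [r0 fE]]].
pose rho := r / 2; have rho0 : 0 < rho by rewrite divr_gt0.
have rhor : rho < r by rewrite ltr_pdivrMr// ltr_pMr// ltr1n.
have [M M0 aM] : exists2 M : R, 0 <= M & forall n, normc (a n) * rho ^+ n <= M.
  have /fE : normc (c + rho%:C%C - c) < r.
    by rewrite addrC addKr /= expr0n addr0 sqrtr_sqr gtr0_norm.
  move=> /cvgP/cvg_series_cvg_0/cvgP/cvg_seq_bounded[M [Mreal aM]].
  have /aM h : M < `|M| + 1 by rewrite (le_lt_trans (real_ler_norm Mreal))// ltrDl.
  exists (normc M + 1) => [|n]; first by rewrite addr_ge0 ?normc_ge0.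
  have := h n Logic.I; rewrite [c + _]addrC addrK.
  have -> : `|M| + 1 = (normc M + 1)%:C%C by rewrite rmorphD.
  rewrite /mkset normrE_normc lecR.
  rewrite normcM normcX.
  by rewrite [normc rho%:C%C]/= expr0n addr0 sqrtr_sqr gtr0_norm.
clearbody rho.
pose S z n := \sum_(k < n) a k * (z - c) ^+ k.
have tail z n : normc (z - c) < rho / 2 ->
    normc (f z - S z n) <= 2 * M * (normc (z - c) / rho) ^+ n.
  move=> zc; set x := normc (z - c) / rho.
  have x0 : 0 <= x by rewrite divr_ge0 ?normc_ge0// ltW.
  have x2 : x <= 2^-1 by rewrite ler_pdivrMr// mulrC ltW.
  (* The last factor is the sum of the first j powers of 1/2: a closed form that suits induction and
     stays below 2. *)
  have SN j : normc (S z (n + j)%N - S z n) <= M * x ^+ n * (2 - 2 * 2^-1 ^+ j).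
    elim: j => [|j IH]; first by rewrite addn0 subrr normc0 expr0 mulr1 subrr mulr0.
    rewrite addnS /S big_ord_recr/= -/(S z _) -/(S z n) addrAC.
    apply: le_trans (normc_triangle _ _) _.
    have -> : M * x ^+ n * (2 - 2 * 2^-1 ^+ j.+1) =
        M * x ^+ n * (2 - 2 * 2^-1 ^+ j) + M * x ^+ n * 2^-1 ^+ j.
      by rewrite exprS; field.
    apply: lerD => //; rewrite normcM normcX.
    have -> : normc (a (n + j)%N) * normc (z - c) ^+ (n + j) =
        normc (a (n + j)%N) * rho ^+ (n + j) * (x ^+ n * x ^+ j).
      rewrite -exprD /x expr_div_n; field.
      by rewrite expf_neq0// gt_eqF.
    rewrite -[leRHS]mulrA ler_pM ?mulr_ge0 ?exprn_ge0 ?normc_ge0 ?(ltW rho0)//.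
    by rewrite ler_wpM2l ?exprn_ge0// lerXn2r ?nnegrE// invr_ge0.
  apply/ler_addgt0Pr => e e0.
  have zr : normc (z - c) < r.
    by rewrite (lt_trans zc)// (lt_trans _ rhor)// ltr_pdivrMr// ltr_pMr// ltr1n.
  have /cvg_normcP/(_ _ e0)[N _ /(_ (n + N)%N)] := fE z zr.
  rewrite /= leq_addl /series/= big_mkord -/(S z _) => /(_ isT) fS.
  rewrite -(subrKA (S z (n + N)%N)) (le_trans (normc_triangle _ _))//.
  rewrite addrC lerD ?(ltW fS)// (le_trans (SN N))//.
  rewrite -[2 * M * _]mulrA [leRHS]mulrC ler_wpM2l ?mulr_ge0 ?exprn_ge0//.
  by rewrite gerBl mulr_ge0// exprn_ge0// invr_ge0.
(* At c the quotient would be 0 for n > 0, by the convention 0^-1 = 0; its limit a n is put there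
   instead. *)
pose F n z := if z == c then a n else (f z - S z n) / (z - c) ^+ n.
exists (rho / 2); first by rewrite divr_gt0.
exists F, (2 * M), rho^-1; split.
- by rewrite mulr_ge0.
- by rewrite invr_ge0 ltW.
- move=> z Xz; rewrite /F; case: eqVneq => [->|zc].
    have := tail c 1%N; rewrite subrr normc0 divr_gt0// => /(_ isT).
    rewrite mul0r expr1 mulr0 /S big_ord1 expr0 mulr1 => fa.
    apply/eqP; rewrite eq_sym -subr_eq0; apply/eqP/eq0_normc/eqP.
    by rewrite eq_le fa normc_ge0.
  by rewrite expr0 divr1 /S big_ord0 subr0.
- move=> n z Xz; rewrite /F eqxx; case: eqVneq => [->|zc].
    by rewrite subrr mul0r addr0.
  have u0 : z - c != 0 by rewrite subr_eq0.
  rewrite /S big_ord_recr/= exprS; set u := z - c in u0 *.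
  have un0 : u ^+ n != 0 by rewrite expf_neq0.
  by field; rewrite un0 u0.
- move=> n z Xz; rewrite /F; case: eqVneq => [_|zc].
    rewrite exprVn ler_pdivlMr ?exprn_gt0// (le_trans (aM n))//.
    by rewrite ler_peMl// ler1n.
  rewrite normcM normcV normcX ler_pdivrMr ?exprn_gt0//.
    rewrite (le_trans (tail _ n Xz))// exprMn exprVn.
    by rewrite le_eqVlt; apply/orP; left; apply/eqP; ring.
  rewrite lt_neqAle normc_ge0 andbT eq_sym; apply/eqP => /eq0_normc/eqP.
  by rewrite subr_eq0 (negbTE zc).
Qed.

Lemma expands_analytic f c (r : R) : 0 < r -> expands (cball c r) c f ->
  analytic_at f c.
Proof.
move=> r0 [F [M [K [M0 K0 F0 FS FM]]]].
(* The remainder after n terms is exactly (z - c)^n F_n(z), hence at most M 2^-n on this radius; K +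
   1 avoids dividing by K = 0. *)
exists (fun n => F n c), (Num.min r (2 * (K + 1))^-1).
have K1 : 0 < K + 1 by rewrite ltr_wpDl.
split=> [|z]; first by rewrite lt_min r0 invr_gt0 mulr_gt0.
rewrite lt_min => /andP[zr zK].
have fz n : f z - series (fun n => F n c * (z - c) ^+ n) n = (z - c) ^+ n * F n z.
  rewrite /series/=; elim: n => [|n IH].
    by rewrite big_nil subr0 expr0 mul1r F0.
  by rewrite big_nat_recr//= opprD addrA IH (FS _ _ zr) exprS; ring.
apply/cvg_normcP => e e0.
have bnd n : normc (f z - series (fun n => F n c * (z - c) ^+ n) n) <= M * 2^-1 ^+ n.
  rewrite fz normcM normcX mulrC; apply: (@le_trans _ _ (M * K ^+ n * normc (z - c) ^+ n)).
    by rewrite ler_wpM2r ?exprn_ge0 ?normc_ge0// FM.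
  rewrite -mulrA ler_wpM2l// -exprMn lerXn2r ?nnegrE ?mulr_ge0 ?invr_ge0 ?normc_ge0//.
  apply: (@le_trans _ _ ((K + 1) * normc (z - c))).
    by rewrite ler_wpM2r ?normc_ge0// lerDl.
  by move: zK; rewrite invfM ltr_pdivlMr// => /ltW; rewrite mulrC.
exists (Num.bound (M / e)) => // n /= Nn.
apply: le_lt_trans (bnd n) _.
rewrite exprVn ltr_pdivrMr ?exprn_gt0// mulrC -ltr_pdivrMr//.
apply: lt_le_trans (archi_boundP (divr_ge0 M0 (ltW e0))) _.
by rewrite -natrX ler_nat (leq_trans Nn)// ltnW// ltn_expl.
Qed.

(** If every F_n(c) vanishes, then f z = (z - c)^n F_n(z) for all n, which forces f z = 0 as soon as
    K |z - c| <= 1/2. Otherwise A is the first nonzero F_m(c). As [X] is arbitrary, this serves for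
    arcs as well as for discs. *)
Lemma expands_leading X c f : X c -> expands X c f ->
  (exists2 r : R, 0 < r & forall z, X z -> normc (z - c) < r -> f z = 0) \/
  (exists m A (B : R), [/\ A != 0, 0 <= B & forall z, X z ->
     normc (f z - (z - c) ^+ m * A) <= B * normc (z - c) ^+ m.+1]).
Proof.
move=> Xc [F [M [K [M0 K0 F0 FS FM]]]].
have fE n : (forall k, (k < n)%N -> F k c = 0) ->
    forall z, X z -> f z = (z - c) ^+ n * F n z.
  elim: n => [_ z Xz|n IH Fc z Xz]; first by rewrite expr0 mul1r F0.
  rewrite IH//; first by rewrite (FS _ _ Xz) Fc// add0r exprSr mulrA.
  by move=> k kn; rewrite Fc// ltnS ltnW.
have [Fc|/existsNP[n0 /eqP Fn0]] := pselect (forall n, F n c = 0).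
  left; have K1 : 0 < K + 1 by rewrite ltr_wpDl.
  exists (2 * (K + 1))^-1 => [|z Xz zK]; first by rewrite invr_gt0 mulr_gt0.
  apply: eq0_normc; apply/eqP; rewrite eq_le normc_ge0 andbT.
  apply: (@geometric_le0 _ M) => n.
  rewrite (fE n)// normcM normcX mulrC.
  apply: (@le_trans _ _ (M * K ^+ n * normc (z - c) ^+ n)).
    by rewrite ler_wpM2r ?exprn_ge0 ?normc_ge0// FM.
  rewrite -mulrA ler_wpM2l// -exprMn lerXn2r ?nnegrE ?mulr_ge0 ?invr_ge0 ?normc_ge0//.
  apply: (@le_trans _ _ ((K + 1) * normc (z - c))).
    by rewrite ler_wpM2r ?normc_ge0// lerDl.
  by move: zK; rewrite invfM ltr_pdivlMr// => /ltW; rewrite mulrC.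
right; have ex : exists n, F n c != 0 by exists n0.
case: (ex_minnP ex) => m Fm mmin.
exists m, (F m c), (M * K ^+ m.+1); split=> //.
  by rewrite mulr_ge0// exprn_ge0.
move=> z Xz; rewrite (fE m)//; last first.
  by move=> k km; apply/eqP/negPn/negP => /mmin; rewrite leqNgt km.
rewrite (FS _ _ Xz) -mulrBr [X in _ * X]addrAC subrr add0r mulrA -exprSr.
rewrite normcM normcX mulrC.
by rewrite ler_wpM2r ?exprn_ge0 ?normc_ge0// FM.
Qed.

End Analytic.

(** * Reflection in the unit circle *)

Section Circle.
Context {R : realType}.
Implicit Types (X : set R[i]) (c z : R[i]) (f g : R[i] -> R[i]).

Lemma normc_conj z : normc (z^*)%C = normc z.
Proof. by case: z => x y /=; rewrite sqrrN. Qed.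

Lemma mulc_conj z : z * (z^*)%C = (normc z ^+ 2)%:C%C.
Proof. by rewrite -sqr_normc normrE_normc rmorphXn. Qed.

(* On the unit circle conj z - conj c = (z - c) v with v = - conj z conj c, and
   v is its own shift up to the factor - conj c; hence the shifts of
   conj (f z) are v times linear combinations of the conj (F_j z). *)
Lemma expands_conj X c f : X `<=` [set z | normc z = 1] -> X c ->
  expands X c f -> expands X c (fun z => (f z)^*%C).
Proof.
move=> X1 Xc [F [M [K [M0 K0 F0 FS FM]]]].
pose v z : R[i] := - (z^*%C * c^*%C).
have conjE z : X z -> z^*%C - c^*%C = (z - c) * v z.
  move=> /X1/= z1; have /= c1 := X1 _ Xc.
  have := mulc_conj z; rewrite z1 expr1n => zz.
  have := mulc_conj c; rewrite c1 expr1n => cc.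
  transitivity (z^*%C * (c * c^*%C) - c^*%C * (z * z^*%C)).
    by rewrite zz cc !mulr1.
  by rewrite /v; ring.
have v1 z : X z -> normc (v z) = 1.
  by move=> /X1/= z1; rewrite normcN normcM !normc_conj z1 (X1 _ Xc) mulr1.
pose G := fix G (n : nat) (j : nat) z : R[i] := match n with
  | 0%N => (F j z)^*%C
  | n.+1 => - c^*%C * G n j z + v c * G n j.+1 z end.
have GE n j z : G n.+1 j z = - c^*%C * G n j z + v c * G n j.+1 z by [].
have FSc n z : X z -> (F n z)^*%C = (F n c)^*%C + (z - c) * v z * (F n.+1 z)^*%C.
  by move=> Xz; rewrite {1}(FS _ _ Xz) rmorphD rmorphM rmorphB conjE.
have GS n j z : X z ->
    v z * G n j z = v c * G n j c + (z - c) * (v z * G n.+1 j z).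
  move=> Xz; elim: n j => [|n IH] j.
    have vE : v z - v c + (z - c) * c^*%C * v z = 0.
      by rewrite {1}/v -[z^*%C](subrK c^*%C) conjE// /v; ring.
    have FE : (F j z)^*%C - (F j c)^*%C - (z - c) * v z * (F j.+1 z)^*%C = 0.
      by rewrite FSc//; ring.
    apply/eqP; rewrite -subr_eq0 /=; apply/eqP.
    transitivity ((v z - v c + (z - c) * c^*%C * v z) * (F j z)^*%C + v c *
      ((F j z)^*%C - (F j c)^*%C - (z - c) * v z * (F j.+1 z)^*%C)); first by ring.
    by rewrite vE FE mul0r mulr0 addr0.
  have -> : v z * G n.+1 j z = - c^*%C * (v z * G n j z) + v c * (v z * G n j.+1 z).
    by rewrite GE; ring.
  by rewrite !IH (GE n.+1 j z) (GE n j c); ring.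
have GM n j z : X z -> normc (G n j z) <= M * K ^+ j * (1 + K) ^+ n.
  move=> Xz; elim: n j => [|n IH] j; first by rewrite normc_conj expr0 mulr1 FM.
  rewrite GE (le_trans (normc_triangle _ _))// !normcM normcN normc_conj.
  rewrite (X1 _ Xc) v1// !mul1r (le_trans (lerD (IH _) (IH _)))//.
  by rewrite !exprS le_eqVlt; apply/orP; left; apply/eqP; ring.
exists (fun n z => if n is n'.+1 then v z * G n' 1%N z else (F 0%N z)^*%C), M, (1 + K).
split=> //.
- by rewrite addr_ge0.
- by move=> z Xz; rewrite F0.
- by move=> [|n] z Xz; [rewrite /= FSc// mulrA|exact: GS].
- move=> [|n] z Xz; first by rewrite normc_conj expr0 (le_trans (FM _ _ Xz)).
  rewrite normcM v1// mul1r (le_trans (GM _ _ _ Xz))// expr1 exprS mulrA.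
  by rewrite ler_wpM2r ?exprn_ge0 ?addr_ge0// ler_wpM2l// lerDr.
Qed.

(** Leading-term alternative for f conj f - 1 = |f|^2 - 1 on an arc around c: it vanishes
    identically near c, or its leading term outweighs the error at the other points near c. *)
Lemma unimodular_dichotomy f c : normc c = 1 -> analytic_at f c ->
  (exists2 r : R, 0 < r & forall z, normc z = 1 -> normc (z - c) < r ->
     normc (f z) = 1) \/
  (exists2 r : R, 0 < r & forall z, normc z = 1 -> normc (z - c) < r ->
     z != c -> normc (f z) != 1).
Proof.
move=> c1 /analytic_expands[r r0 fc].
pose X := cball c r `&` [set z | normc z = 1].
have Xc : X c by split=> //; exact: cball_center.
have fX : expands X c f by apply: expands_sub fc => z [].
have fX' : expands X c (fun z => (f z)^*%C) by apply: expands_conj => // z [].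
have gE z : f z * (f z)^*%C + -1 = (normc (f z) ^+ 2 - 1)%:C%C.
  by rewrite mulc_conj rmorphB.
have sqr1 (x : R) : 0 <= x -> (x ^+ 2 == 1) = (x == 1).
  by move=> x0; rewrite -[1 in LHS](expr1n _ 2) eqrXn2.
have := expandsD (expandsM Xc fX fX') (expands_cst X c (-1)).
move=> /(expands_leading Xc)[[s s0 h]|[m [A [B [A0 B0 h]]]]].
  left; exists (Num.min r s) => [|z z1]; rewrite lt_min ?r0// => /andP[zr zs].
  have := h z (conj zr z1) zs; rewrite gE => -[/eqP].
  by rewrite subr_eq0 sqr1 ?normc_ge0// => /eqP.
right.
have nA0 : 0 < normc A.
  by rewrite lt_neqAle normc_ge0 andbT eq_sym; apply: contra A0 => /eqP/eq0_normc ->.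
have B1 : 0 < B + 1 by rewrite ltr_wpDl.
exists (Num.min r (normc A / (B + 1))) => [|z z1].
  by rewrite lt_min r0 divr_gt0.
rewrite lt_min => /andP[zr zA] zc; apply/eqP => fz1.
have := h z (conj zr z1); rewrite gE fz1 expr1n subrr sub0r normcN normcM normcX.
have zc0 : 0 < normc (z - c).
  rewrite lt_neqAle normc_ge0 andbT eq_sym; apply: contra zc.
  by move=> /eqP/eq0_normc/eqP; rewrite subr_eq0.
rewrite exprSr mulrCA ler_pM2l ?exprn_gt0// leNgt => /negP; apply.
move: zA; rewrite ltr_pdivlMr// mulrC; apply: le_lt_trans.
by rewrite ler_wpM2r ?normc_ge0// lerDl.
Qed.

End Circle.

(** * The maximum modulus principle *)

Section MaximumModulus.
Context {R : realType}.
Implicit Types (X : set R[i]) (c z : R[i]) (f g : R[i] -> R[i]).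

Lemma normc_gt0 z : (0 < normc z) = (z != 0).
Proof.
rewrite lt_neqAle normc_ge0 andbT eq_sym; congr (~~ _).
by apply/eqP/eqP => [/eq0_normc//|->]; rewrite normc0.
Qed.

Lemma normc_real (x : R) : normc x%:C%C = `|x|.
Proof. by rewrite /= expr0n addr0 sqrtr_sqr. Qed.

(** Near c, f is f c + A (z - c)^m up to higher order. Moving from c in a direction w for which A
    w^m points the same way as f c increases |f|. *)
Lemma expands_no_local_max f c (r : R) : 0 < r -> expands (cball c r) c f ->
  (exists2 s : R, 0 < s & forall z, normc (z - c) < s -> f z = f c) \/
  (forall s : R, 0 < s -> exists2 z, normc (z - c) < s & normc (f c) < normc (f z)).
Proof.
move=> r0 fc; have Xc := cball_center c r0.
have := expandsD fc (expands_cst _ c (- f c)).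
move=> /(expands_leading Xc)[[s s0 h]|[m [A [B [A0 B0 h]]]]].
  left; exists (Num.min r s) => [|z]; rewrite lt_min ?r0// => /andP[zr zs].
  by apply/eqP; rewrite -subr_eq0 (h z zr zs).
right=> s s0.
have m0 : (0 < m)%N.
  rewrite lt0n; apply: contra A0 => /eqP m0; move: (h c Xc).
  rewrite m0 !subrr normc0 expr0 mul1r expr1 mulr0 sub0r normcN => A0.
  by apply/eqP/eq0_normc/eqP; rewrite eq_le A0 normc_ge0.
(* [D] is the intended displacement of the value; if f c = 0, any nonzero displacement increases the
   modulus. *)
pose D := if f c == 0 then A else f c.
have D0 : D != 0 by rewrite /D; case: ifPn.
have fcD x : 0 <= x -> normc (f c + x%:C%C * D) = normc (f c) + x * normc D.
  move=> x0; rewrite /D; case: eqP => [->|_].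
    by rewrite normc0 !add0r normcM normc_real ger0_norm.
  rewrite -{1}[f c]mul1r -mulrDl normcM -[1 + _]/(1%:C%C + x%:C%C) -rmorphD.
  by rewrite normc_real ger0_norm ?addr_ge0// mulrDl mul1r.
pose w : R[i] := (m.-root (D / A))%R.
have wA : w ^+ m * A = D by rewrite rootCK// divfK.
have w0 : w != 0 by apply: contraNneq D0 => w0; rewrite -wA w0 expr0n gtn_eqF// mul0r.
have nw0 : 0 < normc w by rewrite normc_gt0.
have nD0 : 0 < normc D by rewrite normc_gt0.
pose N := B * normc w ^+ m.+1 + 1.
have N0 : 0 < N by rewrite ltr_wpDl// mulr_ge0// exprn_ge0// ltW.
(* The first bound keeps the point within distance min(r, s) of c, the second makes the error B (t
   |w|)^(m+1) smaller than the gain t^m |D|. *)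
pose t := Num.min (Num.min r s / (2 * normc w)) (normc D / (2 * N)).
have t0 : 0 < t by rewrite lt_min !divr_gt0 ?mulr_gt0// lt_min r0.
have tw : normc (c + t%:C%C * w - c) < Num.min r s.
  rewrite addrC addKr normcM normc_real gtr0_norm// -ltr_pdivlMr//.
  apply: (@le_lt_trans _ _ (Num.min r s / (2 * normc w))).
    by rewrite ge_min lexx.
  rewrite ltr_pM2l ?lt_min ?r0// ltf_pV2 ?posrE ?mulr_gt0//.
  by rewrite ltr_pMl// ltr1n.
exists (c + t%:C%C * w); first by move: tw; rewrite lt_min => /andP[].
have /h : cball c r (c + t%:C%C * w) by move: tw; rewrite lt_min => /andP[].
rewrite [c + _ - c]addrC addKr.
rewrite exprMn -mulrA wA -rmorphXn normcM normc_real (gtr0_norm t0) exprMn => fz.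
have := fcD _ (exprn_ge0 m (ltW t0)) => fDE.
have : normc (f c + (t ^+ m)%:C%C * D) <= normc (f (c + t%:C%C * w)) +
    B * (t ^+ m.+1 * normc w ^+ m.+1).
  apply: le_trans (lerD (lexx _) fz).
  rewrite -[X in _ <= _ + X]normcN; apply: le_trans (normc_triangle _ _).
  by rewrite le_eqVlt; apply/orP; left; apply/eqP; congr normc; ring.
rewrite fDE => /(lt_le_trans _) h1.
rewrite -(ltrD2r (B * (t ^+ m.+1 * normc w ^+ m.+1))); apply: h1.
rewrite ltrD2l mulrCA exprSr -!mulrA ltr_pM2l ?exprn_gt0//.
apply: (@le_lt_trans _ _ (t * N)).
  by rewrite ler_wpM2l ?(ltW t0)// lerDl.
rewrite -ltr_pdivlMr// (@le_lt_trans _ _ (normc D / (2 * N)))//.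
  by rewrite ge_min lexx orbT.
by rewrite ltr_pM2l// ltf_pV2 ?posrE ?mulr_gt0// ltr_pMl// ltr1n.
Qed.

Lemma continuous_normc : continuous (@normc R : R[i] -> R).
Proof.
move=> z; apply/(@cvgrPdist_lt _ _ _ (nbhs z)) => e e0.
have /(cvg_normcP (nbhs_filter z))/(_ _ e0) : (fun w : R[i] => w) @ z --> z by [].
by apply: filterS => w; apply: le_lt_trans; exact: normc_dist.
Qed.

Lemma closed_normc_le (s : R) : closed [set z | normc z <= s].
Proof.
have -> : [set z | normc z <= s] = @normc R @^-1` [set x : R | x <= s] by [].
by apply: preimage_closed; [move=> z _; exact: continuous_normc|exact: closed_le].
Qed.

Lemma compact_normc_le (s : R) : compact [set z | normc z <= s].
Proof.
pose g (u : R * R) : R[i] := (u.1 +i* u.2)%C.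
have gc : continuous g.
  move=> u; apply/cvg_normcP => e e0.
  have e2 : 0 < e / 2 by rewrite divr_gt0.
  have h1 : \forall x \near u, `|u.1 - x.1| < e / 2.
    by have /cvgrPdist_lt/(_ _ e2) : fst x @[x --> u] --> u.1 by exact: cvg_fst.
  have h2 : \forall x \near u, `|u.2 - x.2| < e / 2.
    by have /cvgrPdist_lt/(_ _ e2) : snd x @[x --> u] --> u.2 by exact: cvg_snd.
  near=> x; apply: le_lt_trans (normc_abs_le _) _ => /=.
  by rewrite [ltRHS]splitr ltrD//; near: x.
apply: (@subclosed_compact _ _ (g @` (`[(- s), s] `*` `[(- s), s]))).
- exact: closed_normc_le.
- apply: continuous_compact; first exact: continuous_subspaceT.
  by apply: compact_setX; exact: segment_compact.
- move=> [x y] /= xys; exists (x, y) => //=.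
  have s0 : 0 <= s by apply: le_trans xys; exact: sqrtr_ge0.
  have h (a b : R) : Num.sqrt (a ^+ 2 + b ^+ 2) <= s -> a \in `[- s, s].
    move=> abs; rewrite in_itv/= -ler_norml (le_trans _ abs)//.
    by rewrite -sqrtr_sqr ler_wsqrtr// lerDl sqr_ge0.
  by split; [exact: h xys|apply: (h y x); rewrite addrC].
Unshelve. all: by end_near. Qed.

Definition locally_expands (U : set R[i]) f := forall c, U c ->
  exists2 r : R, 0 < r & expands (cball c r) c f.

Lemma locally_expands_continuous U f c : locally_expands U f -> U c ->
  {for c, continuous f}.
Proof. by move=> fU /fU[r r0 /(expands_analytic r0)/analytic_continuous]. Qed.

(** Connectedness is avoided by an extremal choice: among the maximisers of |f| on the closed disc,
    take d farthest from 0. If |d| < s, then f is constant near d, and a point slightly farther out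
    on the same ray is again a maximiser. *)
Lemma maximum_modulus f (s : R) : 0 <= s ->
  locally_expands [set z | normc z <= s] f ->
  forall z, normc z <= s -> exists2 w, normc w = s & normc (f z) <= normc (f w).
Proof.
move=> s0 fa.
have fcont c : normc c <= s -> {for c, continuous (fun z => normc (f z))}.
  move=> cs; apply: continuous_comp; last exact: continuous_normc.
  exact: (locally_expands_continuous fa).
have [||c /[!inE]/= cs cmax] := @compact_EVT_max _ _ (fun z => normc (f z)) _ _ (@compact_normc_le s).
- by exists 0; rewrite /mkset normc0.
- by apply: continuous_in_subspaceT => z /[!inE]/=; exact: fcont.
pose K := [set z | normc z <= s /\ normc (f z) = normc (f c)].
have Kcl : closed K.
  move=> z clz.
  have zs : normc z <= s.
    have /(_ z) := @closed_normc_le s; apply.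
    by apply: (@closureS _ K) clz => w [].
  split=> //; apply/eqP/negPn/negP => fz.
  have : \forall w \near z, normc (f w) != normc (f c).
    have : nbhs (normc (f z)) [set x | x != normc (f c)].
      by apply: open_nbhs_nbhs; split=> //; exact: open_neq.
    by move=> /(fcont z zs).
  by move=> /clz[w [[_ ->] /=]]; rewrite eqxx.
have Kc : compact K.
  by apply: subclosed_compact Kcl (@compact_normc_le s) _ => w [].
have [||d /[!inE]/= -[ds fd] dmax] := @compact_EVT_max _ _ (@normc R) _ _ Kc.
- by exists c.
- by apply: continuous_subspaceT; exact: continuous_normc.
suff ds1 : normc d = s by move=> z zs; exists d => //; rewrite fd cmax ?inE.
apply/eqP; rewrite eq_le ds leNgt; apply/negP => dlts.
pose t := s - normc d; have t0 : 0 < t by rewrite subr_gt0.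
have near_s z : normc (z - d) < t -> normc z <= s.
  move=> zd; rewrite -(subrK d z) (le_trans (normc_triangle _ _))//.
  by rewrite -lerBrDr ltW.
have [r r0 /(expands_no_local_max r0)[[u u0 h]|/(_ _ t0)[z zt]]] := fa _ ds; last first.
  by rewrite fd ltNge cmax// inE /= near_s.
pose v := Num.min u t / 2.
have v0 : 0 < v by rewrite divr_gt0// lt_min u0.
have vut : v < Num.min u t by rewrite ltr_pdivrMr// ltr_pMr ?ltr1n// lt_min u0.
have [w w1 wd] : exists2 w, normc w = 1 & d = (normc d)%:C%C * w.
  have [->|d0] := eqVneq d 0; first by exists 1; rewrite ?normc1// normc0 mul0r.
  exists (d / (normc d)%:C%C).
    by rewrite normcM normcV normc_real ger0_norm ?normc_ge0// divff// gt_eqF// normc_gt0.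
  by rewrite mulrC divfK//; apply: contraNneq d0 => -[/eq0_normc ->].
have dw : normc (d + v%:C%C * w - d) = v.
  by rewrite addrC addKr normcM w1 mulr1 normc_real gtr0_norm.
have := dmax (d + v%:C%C * w); rewrite inE /=.
have /[swap] /[apply] : K (d + v%:C%C * w).
  split; first by apply: near_s; rewrite dw (lt_le_trans vut)// ge_min lexx orbT.
  by rewrite h ?fd// dw (lt_le_trans vut)// ge_min lexx.
rewrite {1}wd -mulrDl -rmorphD normcM w1 mulr1 normc_real.
by rewrite ger0_norm ?addr_ge0 ?normc_ge0 ?(ltW v0)// gerDl leNgt v0.
Qed.

End MaximumModulus.

(** * Integrals of periodic functions *)

Section CircleIntegral.
Context {R : realType}.
Implicit Types (g h : R -> R).
Local Notation mu := (@lebesgue_measure R).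

Definition circ g : R := \int[mu]_(t in `[0%R, (2 * pi)%R]) g t.

Lemma pi2_gt0 : 0 < 2 * pi :> R.
Proof. by rewrite mulr_gt0// pi_gt0. Qed.

Lemma continuous_integrable g (a b : R) : continuous g ->
  mu.-integrable `[a, b] (EFin \o g).
Proof.
move=> gc; apply: continuous_compact_integrable; first exact: segment_compact.
exact: continuous_subspaceT.
Qed.

Lemma circ_EFin g : continuous g ->
  (\int[mu]_(t in `[0%R, (2 * pi)%R]) (g t)%:E)%E = (circ g)%:E.
Proof.
move=> gc; rewrite /circ /Rintegral fineK//.
by apply: integrable_fin_num => //; exact: continuous_integrable.
Qed.

Lemma circ_le g h : continuous g -> continuous h ->
  (forall t, 0 <= t <= 2 * pi -> g t <= h t) -> circ g <= circ h.
Proof.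
move=> gc hc gh; apply: le_Rintegral.
- exact: measurable_itv.
- exact: continuous_integrable.
- exact: continuous_integrable.
- by move=> t; rewrite /= in_itv/=; exact: gh.
Qed.

Lemma circD g h : continuous g -> continuous h ->
  circ (fun t => g t + h t) = circ g + circ h.
Proof.
by move=> gc hc; apply: RintegralD => //; exact: continuous_integrable.
Qed.

Lemma circB g h : continuous g -> continuous h ->
  circ (fun t => g t - h t) = circ g - circ h.
Proof.
by move=> gc hc; apply: RintegralB => //; exact: continuous_integrable.
Qed.

Lemma circZ (k : R) g : continuous g -> circ (fun t => k * g t) = k * circ g.
Proof.
by move=> gc; apply: RintegralZl => //; exact: continuous_integrable.
Qed.

Lemma circ_ge0 g : (forall t, 0 <= g t) -> 0 <= circ g.
Proof. by move=> g0; exact: Rintegral_ge0. Qed.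

Lemma circ_primitive g : continuous g -> exists2 G : R -> R,
  (forall x : R, -1 < x -> is_derive x (1 : R) G (g x)) &
  circ g = G (2 * pi) - G 0.
Proof.
(* Integrating from -1 makes 0 an interior point, so G has two-sided derivatives on all of
   [0, 2 pi]. *)
move=> gc; pose G x : R := \int[mu]_(t in `[(-1)%R, x]) g t.
have dG (x : R) : -1 < x -> is_derive x (1 : R) G (g x).
  move=> x1.
  have [||||dG GE] := @continuous_FTC1_closed R g (-1) x (x + 1) => //.
  - by rewrite ltrDl.
  - exact: continuous_integrable.
  - exact: gc.
  - by rewrite -GE derive1E; exact: DeriveDef.
exists G => //.
apply: EFin_inj; rewrite -circ_EFin// EFinB.
have Gc (x : R) : -1 < x -> {for x, continuous G}.
  move=> /dG [dGx _]; exact/differentiable_continuous/derivable1_diffP.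
apply: continuous_FTC2; first exact: pi2_gt0.
- exact: continuous_subspaceT.
- split.
  + by move=> x /[!in_itv]/= /andP[x0 _]; have [] := dG x (lt_trans (ltrN10 R) x0).
  + by apply: cvg_at_right_filter; apply: Gc; rewrite ltrN10.
  + by apply: cvg_at_left_filter; apply: Gc; rewrite (lt_trans (ltrN10 R))// pi2_gt0.
- move=> x /[!in_itv]/= /andP[x0 _]; have [_] := dG x (lt_trans (ltrN10 R) x0).
  by rewrite derive1E.
Qed.

Lemma segment_unif_continuous g (a b e : R) : continuous g -> 0 < e ->
  exists2 d : R, 0 < d & forall x y, a <= x <= b -> `|x - y| < d ->
    `|g x - g y| < e.
Proof.
move=> gc e0.
(* Compactness in this form: a property that holds near each point for all small d > 0 holds on the
   whole segment for a common d. *)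
have := @segment_compact R a b; rewrite compact_near_coveringP => /(_ R 0^'+
  (fun d x => forall y, `|x - y| < d -> `|g x - g y| < e)).
have e2 : 0 < e / 2 by rewrite divr_gt0.
case.
- move=> x _.
  have /cvgrPdist_lt/(_ _ e2)/nbhs_ballP[d /= d0 dg] := gc x.
  have d2 : 0 < d / 2 by rewrite divr_gt0.
  near=> x' k => /= y x'y.
  have xx' : `|x - x'| < d / 2.
    by near: x'; exact: (nbhsx_ballx x (d / 2) d2).
  have kd : k <= d / 2 by near: k; exact: nbhs_right_le.
  rewrite -(subrKA (g x)) (le_lt_trans (ler_normD _ _))// [ltRHS]splitr ltrD//.
    rewrite distrC; apply: dg; rewrite -ball_normE /ball_/= (lt_trans xx')//.
    by rewrite ltr_pdivrMr// ltr_pMr// ltr1n.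
  apply: dg; rewrite -ball_normE /ball_/= -(subrKA x').
  rewrite (le_lt_trans (ler_normD _ _))// [ltRHS]splitr ltrD//.
  exact: lt_le_trans kd.
- move=> d /= d0 hd; exists (d / 2); first by rewrite divr_gt0.
  move=> x y xab; apply: (hd (d / 2)) => //=; last first.
  + by rewrite divr_gt0.
  + by rewrite sub0r normrN gtr0_norm ?divr_gt0// ltr_pdivrMr// ltr_pMr// ltr1n.
Unshelve. all: by end_near. Qed.

(* Telescoping a primitive of g over the n points tau + 2 pi j / n, the mean
   value theorem compares each increment with g at a point of the interval. *)
Lemma riemann_circ g (e : R) : continuous g -> periodic g (2 * pi) -> 0 < e ->
  exists N : nat, forall n, (N <= n)%N -> (0 < n)%N ->
    forall tau : R, 0 <= tau <= 2 * pi ->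
    `|2 * pi / n%:R * \sum_(j < n) g (tau + 2 * pi / n%:R * j%:R) - circ g| <= e.
Proof.
move=> gc gp e0.
have [G dG ->] := circ_primitive gc.
have Gc (x : R) : -1 < x -> {for x, continuous G}.
  by move=> /dG [dGx _]; exact/differentiable_continuous/derivable1_diffP.
have mvt (f df : R -> R) (a b : R) : 0 <= a -> a <= b ->
    (forall x : R, -1 < x -> is_derive x (1 : R) f (df x)) ->
    exists2 c, a <= c <= b & f b - f a = df c * (b - a).
  move=> a0 ab fd.
  have [||x /[!in_itv]/= xab fE] := @MVT_segment R f df a b ab.
  - move=> x /[!in_itv]/= /andP[ax _]; apply: fd.
    by rewrite (le_lt_trans _ ax)// (le_trans _ a0)// oppr_le0.
  - apply: continuous_in_subspaceT => x /[!inE]/= /[!in_itv]/= /andP[ax _].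
    have [|dfx _] := fd x; last exact/differentiable_continuous/derivable1_diffP.
    by rewrite (lt_le_trans (ltrN10 R))// (le_trans a0).
  by exists x.
(* By periodicity x |-> G (x + 2 pi) - G x has derivative 0, so the integral over a period starting
   at any tau is the same. This makes N independent of tau. *)
have shift (tau : R) : 0 <= tau -> G (2 * pi) - G 0 = G (tau + 2 * pi) - G tau.
  move=> tau0.
  have [x x1|c _] := mvt (fun x => G (x + 2 * pi) - G x) (fun=> 0) 0 tau (lexx _) tau0.
    have x2 : -1 < x + 2 * pi :> R by rewrite ltr_wpDr// ltW// pi2_gt0.
    pose sh : R -> R := id + cst (2 * pi).
    have d2 : is_derive x (1 : R) (G \o sh) (g (x + 2 * pi) * (1 + 0)).
      exact: (@is_derive1_comp _ G sh) (dG _ x2) _.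
    have := is_deriveB d2 (dG x x1).
    by rewrite addr0 mulr1 gp subrr.
  by rewrite mul0r add0r => /eqP; rewrite subr_eq0 => /eqP ->.
(* The nodes are tau plus at most one period with tau <= 2 pi, hence the segment up to 4 pi. *)
have [d d0 dg] := segment_unif_continuous 0 (4 * pi) gc (divr_gt0 e0 pi2_gt0).
exists (Num.bound (2 * pi / d)).+1 => n Nn n0 tau /andP[tau0 tau2].
have nR : 0 < n%:R :> R by rewrite ltr0n.
pose s : R := 2 * pi / n%:R; have s0 : 0 < s by rewrite divr_gt0// pi2_gt0.
have sd : s < d.
  rewrite ltr_pdivrMr// [d * _]mulrC -ltr_pdivrMr//.
  have pd : 0 <= 2 * pi / d by rewrite divr_ge0// ltW// pi2_gt0.
  by apply: (lt_le_trans (archi_boundP pd)); rewrite ler_nat ltnW.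
pose x j := tau + s * j%:R.
have xn : x n = tau + 2 * pi by rewrite /x /s divfK// gt_eqF.
have -> : G (2 * pi) - G 0 = \sum_(j < n) (G (x j.+1) - G (x j)).
  transitivity (G (x n) - G (x 0%N)).
    by rewrite xn /x mulr0 addr0; exact: shift.
  by rewrite -(telescope_sumr (fun j => G (x j)))// big_mkord.
rewrite -/s mulr_sumr -sumrB (le_trans (ler_norm_sum _ _ _))//.
have -> : e = \sum_(j < n) (s * (e / (2 * pi))).
  rewrite sumr_const card_ord -[RHS]mulr_natr /s.
  have := gt_eqF pi2_gt0; generalize (2 * pi : R) => P /negbT P0.
  by field; rewrite P0 (gt_eqF nR).
apply: ler_sum => j _; rewrite -/(x j).
have x0 : 0 <= x j by rewrite addr_ge0// mulr_ge0// ltW.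
have xS : x j.+1 - x j = s.
  by rewrite /x -natr1 mulrDr mulr1 addrA [LHS]addrC addKr.
have [|c /andP[c1 c2] ->] := mvt G g (x j) (x j.+1) x0 _ dG.
  by rewrite -subr_ge0 xS ltW.
rewrite xS [g c * s]mulrC -mulrBr normrM gtr0_norm// ler_wpM2l ?(ltW s0)//.
rewrite ltW// dg//.
  rewrite x0/= /x (_ : 4 * pi = 2 * pi + s * n%:R); last first.
    by rewrite /s divfK ?gt_eqF//; ring.
  by rewrite lerD// ler_wpM2l ?(ltW s0)// ler_nat ltnW.
rewrite ler0_norm ?subr_le0// opprB (le_lt_trans _ sd)//.
by rewrite -xS lerB.
Qed.

End CircleIntegral.

(** * Integral means *)

Section Means.
Context {R : realType}.
Implicit Types (f g : R[i] -> R[i]) (p r s : R).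

Lemma expiD (x y : R) : expi (x + y) = expi x * expi y :> R[i].
Proof.
rewrite /expi sinD cosD; apply/eqP.
by rewrite eq_complex /= eqxx/= addrC mulrC [sin y * _]mulrC.
Qed.

Lemma expi_2pi (x : R) : expi (x + 2 * pi) = expi x.
Proof. by rewrite mulr_natl /expi cosD2pi sinD2pi. Qed.

Lemma continuous_expi : continuous (@expi R).
Proof.
move=> t; apply/(@cvg_normcP _ _ _ (nbhs_filter t)) => e e0.
have e2 : 0 < e / 2 by rewrite divr_gt0.
have h1 : \forall x \near t, `|cos t - cos x| < e / 2.
  by have /cvgrPdist_lt := @continuous_cos R t; exact.
have h2 : \forall x \near t, `|sin t - sin x| < e / 2.
  by have /cvgrPdist_lt := @continuous_sin R t; exact.
near=> x; apply: le_lt_trans (normc_abs_le _) _ => /=.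
by rewrite [ltRHS]splitr ltrD//; near: x.
Unshelve. all: by end_near. Qed.

Lemma polar (z : R[i]) :
  exists2 t : R, 0 <= t <= 2 * pi & z = (normc z)%:C%C * expi t.
Proof.
have [->|z0] := eqVneq z 0.
  by exists 0; rewrite ?lexx ?(ltW pi2_gt0)// normc0 mul0r.
have nz0 : normc z != 0 by rewrite gt_eqF// normc_gt0.
suff [t tpi tE] : exists2 t : R, 0 <= t <= 2 * pi & z / (normc z)%:C%C = expi t.
  exists t => //; rewrite -tE mulrC divfK//.
  by apply: contra nz0 => /eqP[/eqP].
have : normc (z / (normc z)%:C%C) = 1.
  by rewrite normcM normcV normc_real ger0_norm ?normc_ge0// divff.
case: (z / _) => x y /=; clear => xy.
have xy1 : x ^+ 2 + y ^+ 2 = 1.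
  by rewrite -[RHS](expr1n _ 2) -xy sqr_sqrtr// addr_ge0// sqr_ge0.
have x1 : -1 <= x <= 1.
  rewrite -ler_norml -(@ler_pXn2r _ 2) ?nnegrE// expr1n real_normK ?num_real//.
  by rewrite -xy1 lerDl sqr_ge0.
have y2 : 1 - x ^+ 2 = y ^+ 2 by rewrite -xy1 addrC addKr.
have ac := acos_ge0 x1; have acpi := acos_lepi x1.
have [y0|y0] := leP 0 y.
  exists (acos x).
    by rewrite ac (le_trans acpi)// mulr_natl mulr2n lerDl pi_ge0.
  by rewrite /expi acosK// sin_acos// y2 sqrtr_sqr ger0_norm.
exists (2 * pi - acos x).
  rewrite subr_ge0 gerBl ac andbT (le_trans acpi)// mulr_natl mulr2n lerDl.
  exact: pi_ge0.
rewrite /expi -[2 * pi - _]opprB cosN sinN -(cosD2pi (acos x - _)) -(sinD2pi (acos x - _)).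
rewrite mulr_natl subrK acosK// sin_acos// y2 sqrtr_sqr ltr0_norm// opprK.
by [].
Qed.

Lemma continuous_powR_comp (T : topologicalType) (u : T -> R) p (t : T) :
  1 <= p -> (forall x, 0 <= u x) -> {for t, continuous u} ->
  {for t, continuous (fun x => u x `^ p)}.
Proof.
move=> p1 u0 uc; have p0 : 0 < p by rewrite (lt_le_trans ltr01).
have := u0 t; rewrite le_eqVlt => /predU1P[ut|ut]; last first.
  apply: (@continuous_comp _ _ _ u (fun a => a `^ p)) => //.
  apply/differentiable_continuous/derivable1_diffP/derivable_powR.
  by rewrite in_itv/= andbT.
(* At a zero of u, differentiability of the power is replaced by a^p <= a for 0 < a <= 1. *)
apply/(@cvgrPdist_lt _ _ _ (nbhs t)) => e e0; rewrite -ut powR0 ?gt_eqF//.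
have m0 : 0 < Num.min e 1 by rewrite lt_min e0 ltr01.
have /(@cvgrPdist_lt _ _ _ (nbhs t))/(_ _ m0) := uc.
apply: filterS => x; rewrite -ut !sub0r !normrN !ger0_norm ?powR_ge0 ?u0//.
rewrite lt_min => /andP[ue u1]; have := u0 x.
rewrite le_eqVlt => /predU1P[<-|ux]; first by rewrite powR0 ?gt_eqF.
by rewrite (le_lt_trans _ ue)// ge1r_powR// ux ltW.
Qed.

(* Not normalised: 2 pi times the mean in the Hardy norm. *)
Definition mean p f r := circ (fun t => normc (f (r%:C%C * expi t)) `^ p).

Lemma continuous_circle p f r : 1 <= p -> 0 <= r ->
  locally_expands [set z | normc z <= r] f ->
  continuous (fun t => normc (f (r%:C%C * expi t)) `^ p).
Proof.
move=> p1 r0 fr t.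
apply: (@continuous_powR_comp _ (fun t => normc (f (r%:C%C * expi t)))) => // [x|].
  exact: normc_ge0.
apply: (@continuous_comp _ _ _ (fun t => f (r%:C%C * expi t))); last first.
  exact: continuous_normc.
apply: (@continuous_comp _ _ _ (fun t => r%:C%C * expi t)).
  by apply: cvgM; [exact: cvg_cst|exact: continuous_expi].
apply: (locally_expands_continuous fr).
by rewrite /mkset normcM normc_real expi_norm mulr1 ger0_norm.
Qed.

(** Young's inequality for x^(p-1) and y with exponents p/(p-1) and p; for p = 1 the first exponent
    would be infinite, hence the separate case. *)
Lemma powR_young p (x y : R) : 1 <= p -> 0 < x -> 0 <= y ->
  x `^ p / x * y <= (1 - p^-1) * x `^ p + p^-1 * y `^ p.
Proof.
rewrite le_eqVlt => /predU1P[<-|p1] x0 y0.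
  by rewrite invr1 subrr mul0r add0r mul1r !powRr1 ?(ltW x0)// divff ?gt_eqF// mul1r.
have p0 : 0 < p by rewrite (lt_trans ltr01).
have q0 : 0 < 1 - p^-1 by rewrite subr_gt0 invf_lt1.
have qE : p^-1 + (1 - p^-1)^-1^-1 = 1 by rewrite invrK addrC subrK.
have q1 : 0 < (1 - p^-1)^-1 by rewrite invr_gt0.
have := conjugate_powR y0 (powR_ge0 x (p - 1)) p0 q1 qE; rewrite invrK.
rewrite -powRrM (_ : (p - 1) * (1 - p^-1)^-1 = p); last first.
  by field; rewrite ?subr_eq0 !gt_eqF.
rewrite powRB ?gt_eqF ?implybT// powRr1 ?(ltW x0)//.
move=> h; rewrite mulrC (le_trans h)// le_eqVlt; apply/orP; left; apply/eqP.
ring.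
Qed.

Lemma locally_expandsD U f g : locally_expands U f -> locally_expands U g ->
  locally_expands U (fun z => f z + g z).
Proof.
move=> fU gU c Uc; have [r r0 fr] := fU c Uc; have [s s0 gs] := gU c Uc.
exists (Num.min r s); first by rewrite lt_min r0.
by apply: expandsD; [apply: expands_sub fr|apply: expands_sub gs];
  move=> z; rewrite /cball/= lt_min => /andP[].
Qed.

Lemma locally_expandsM U f g : locally_expands U f -> locally_expands U g ->
  locally_expands U (fun z => f z * g z).
Proof.
move=> fU gU c Uc; have [r r0 fr] := fU c Uc; have [s s0 gs] := gU c Uc.
have rs0 : 0 < Num.min r s by rewrite lt_min r0.
exists (Num.min r s) => //; apply: expandsM; first exact: cball_center.
- by apply: expands_sub fr => z; rewrite /cball/= lt_min => /andP[].
- by apply: expands_sub gs => z; rewrite /cball/= lt_min => /andP[].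
Qed.

Lemma locally_expandsZ U (b : R[i]) f : locally_expands U f ->
  locally_expands U (fun z => b * f z).
Proof. by move=> fU c /fU[r r0 fr]; exists r => //; exact: expandsZ. Qed.

Lemma locally_expands_sum U (I : Type) (l : seq I) (F : I -> R[i] -> R[i]) :
  (forall i, locally_expands U (F i)) ->
  locally_expands U (fun z => \sum_(i <- l) F i z).
Proof.
move=> FU; elim: l => [|i l IH].
  under eq_fun do rewrite big_nil.
  by move=> c _; exists 1 => //; exact: expands_cst.
by under eq_fun do rewrite big_cons; exact: locally_expandsD.
Qed.

Lemma locally_expands_rot s (b : R[i]) f : normc b = 1 ->
  locally_expands [set z | normc z <= s] f ->
  locally_expands [set z | normc z <= s] (fun z => f (z * b)).
Proof.
move=> b1 fs c cs; have [|r r0 fr] := fs (c * b).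
  by rewrite /mkset normcM b1 mulr1.
exists r => //; apply: expands_sub (expands_rot fr) => z.
by rewrite /cball /mkset -mulrBl normcM b1 mulr1.
Qed.

(* Both means are limits of averages over the n-th roots of unity.  For these,
   apply the maximum principle to z |-> sum_j lambda_j f (z omega_j), where
   lambda_j is chosen to make the value at r equal to sum_j |f (r omega_j)|^p. *)
Lemma mean_le p f r s : 1 <= p -> 0 <= r -> r <= s ->
  locally_expands [set z | normc z <= s] f -> mean p f r <= mean p f s.
Proof.
move=> p1 r0 rs fs; have s0 := le_trans r0 rs.
have p0 : 0 < p by rewrite (lt_le_trans ltr01).
have fr : locally_expands [set z | normc z <= r] f.
  by move=> c cr; apply: fs; exact: le_trans rs.
have gr := continuous_circle p1 r0 fr.
have gs := continuous_circle p1 s0 fs.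
have per q : periodic (fun t => normc (f (q%:C%C * expi t)) `^ p) (2 * pi).
  by move=> t; rewrite expi_2pi.
apply/ler_addgt0Pr => e e0; have e2 : 0 < e / 2 by rewrite divr_gt0.
have [N1 H1] := riemann_circ gr (per r) e2.
have [N2 H2] := riemann_circ gs (per s) e2.
pose n := (maxn N1 N2).+1.
have n1 : (N1 <= n)%N by rewrite leqW// leq_maxl.
have n2 : (N2 <= n)%N by rewrite leqW// leq_maxr.
have {}H1 := H1 n n1 isT 0; have {}H2 := H2 n n2 isT.
pose th (j : 'I_n) : R := 2 * pi / n%:R * j%:R.
pose F j := f (r%:C%C * expi (th j)).
pose lam j : R[i] := (F j)^*%C * ((normc (F j) `^ p) / normc (F j) ^+ 2)%:C%C.
pose S := \sum_j normc (F j) `^ p.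
have lamE j : lam j * F j = (normc (F j) `^ p)%:C%C.
  rewrite /lam mulrAC [(F j)^*%C * _]mulrC mulc_conj -rmorphM; congr (_%:C%C).
  have [->|Fj] := eqVneq (F j) 0; first by rewrite normc0 powR0 ?gt_eqF// mul0r mulr0.
  by rewrite mulrC divfK// expf_neq0// gt_eqF// normc_gt0.
have nlam j : normc (lam j) = normc (F j) `^ p / normc (F j).
  rewrite normcM normc_conj normc_real ger0_norm; last first.
    by rewrite divr_ge0 ?powR_ge0// exprn_ge0// normc_ge0.
  have [->|Fj] := eqVneq (normc (F j)) 0; first by rewrite mul0r invr0 mulr0.
  by field.
pose L z := \sum_j lam j * f (z * expi (th j)).
have Ls : locally_expands [set z | normc z <= s] L.
  apply: locally_expands_sum => j; apply: locally_expandsZ.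
  by apply: locally_expands_rot fs; exact: expi_norm.
have Lr : L r%:C%C = S%:C%C.
  by rewrite /S rmorph_sum; apply: eq_bigr => j _; rewrite lamE.
have rs' : normc r%:C%C <= s by rewrite normc_real ger0_norm.
(* The argument tau of w is not controlled; the Riemann sum at radius s is therefore taken over
   rotated nodes, and its error bound must be uniform in tau. *)
have [w ws Lw] := maximum_modulus s0 Ls rs'.
have [tau tau2 wE] := polar w.
pose S' := \sum_(j < n) normc (f (s%:C%C * expi (tau + th j))) `^ p.
(* Young's inequality, applied termwise to |lambda_j| |f (w omega_j)|, gives S <= (1 - 1/p) S +
   (1/p) S'; the terms in S cancel, and no Hölder inequality for sums is needed. *)
have SS' : S <= S'.
  have S0 : 0 <= S by apply: sumr_ge0 => j _; exact: powR_ge0.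
  have : S <= \sum_j ((1 - p^-1) * normc (F j) `^ p +
      p^-1 * normc (f (s%:C%C * expi (tau + th j))) `^ p).
    rewrite -[S]ger0_norm// -normc_real -Lr (le_trans Lw)//.
    apply: (@le_trans _ _ (\sum_j normc (lam j * f (w * expi (th j))))).
      rewrite /L; elim/big_ind2 : _ => //; first by rewrite normc0.
      move=> x1 x2 y1 y2 h1 h2; rewrite (le_trans (normc_triangle _ _))//.
      exact: lerD.
    apply: ler_sum => j _; rewrite normcM nlam {1}wE ws -mulrA -expiD.
    have [->|Fj] := eqVneq (F j) 0.
      rewrite normc0 powR0 ?gt_eqF// !mul0r mulr0 add0r mulr_ge0 ?powR_ge0//.
      by rewrite invr_ge0 ltW.
    by apply: powR_young; rewrite ?normc_gt0 ?normc_ge0.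
  rewrite big_split/= -!mulr_sumr -/S -/S' mulrBl mul1r.
  by rewrite -addrA lerDl addrC -mulrBr pmulr_rge0 ?invr_gt0// subr_ge0.
have {}H2 := H2 _ tau2.
have : 2 * pi / n%:R * S <= 2 * pi / n%:R * S'.
  by rewrite ler_wpM2l// divr_ge0 ?(ltW pi2_gt0).
have : 2 * pi / n%:R * S' <= mean p f s + e / 2.
  by rewrite -lerBlDl (le_trans (ler_norm _)).
have : mean p f r <= 2 * pi / n%:R * S + e / 2.
  rewrite -lerBlDl (le_trans (ler_norm _))// distrC.
  have -> : S = \sum_(j < n) normc (f (r%:C%C * expi (0 + 2 * pi / n%:R * j%:R))) `^ p.
    by apply: eq_bigr => j _; rewrite add0r.
  by apply: H1; rewrite lexx (ltW pi2_gt0).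
move=> h1 h2 h3; rewrite (le_trans h1)// [e in leRHS]splitr addrA lerD2r.
exact: le_trans h2.
Qed.

End Means.

(** * Absence of point masses *)

Section NoAtom.
Context {R : realType}.
Implicit Types (f g : R[i] -> R[i]) (b : R[i]) (p : R).

Lemma disc_locally_expands f (s : R) : locally_expands disc f -> s < 1 ->
  locally_expands [set z | normc z <= s] f.
Proof. by move=> fd s1 c cs; apply: fd; exact: le_lt_trans s1. Qed.

Lemma mean_ge0 p f (r : R) : 0 <= mean p f r.
Proof. by apply: circ_ge0 => t; exact: powR_ge0. Qed.

(** This is Young's inequality for the pair 1 and 1 - x, multiplied by p. *)
Lemma powR_bernoulli p (x : R) : 1 <= p -> 0 <= x <= 1 -> 1 - p * x <= (1 - x) `^ p.
Proof.
move=> p1 /andP[x0 x1]; have p0 : 0 < p by rewrite (lt_le_trans ltr01).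
have := @powR_young R p 1 (1 - x) p1 ltr01; rewrite subr_ge0 => /(_ x1).
rewrite powR1 divr1 mul1r mulr1 -lerBlDl => h.
have := ler_wpM2l (ltW p0) h; rewrite mulrA divff ?gt_eqF// mul1r; apply: le_trans.
by rewrite le_eqVlt; apply/orP; left; apply/eqP; field; rewrite gt_eqF.
Qed.

(** The squares of the two sides differ by 2 e (1 - Re (z conj b)) + e^2, and Re (z conj b) <= 1. *)
Lemma le_normc_outside b (z : R[i]) (e : R) : normc b = 1 -> normc z <= 1 ->
  0 <= e -> normc (b - z) <= normc ((1 + e)%:C%C * b - z).
Proof.
case: b z => [b1 b2] [x y] /= b1E z1 e0; apply: ler_wsqrtr.
have bb : b1 ^+ 2 + b2 ^+ 2 = 1.
  by rewrite -[RHS](expr1n _ 2) -b1E sqr_sqrtr// addr_ge0// sqr_ge0.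
have zz : x ^+ 2 + y ^+ 2 <= 1.
  rewrite -[leRHS](expr1n _ 2) -[leLHS]sqr_sqrtr ?addr_ge0 ?sqr_ge0//.
  by rewrite ler_pXn2r ?nnegrE ?sqrtr_ge0.
rewrite !mul0r subr0 addr0 -subr_ge0.
have bz : 0 <= 1 - (b1 * x + b2 * y).
  have := addr_ge0 (sqr_ge0 (b1 - x)) (sqr_ge0 (b2 - y)); nra.
have -> : ((1 + e) * b1 - x) ^+ 2 + ((1 + e) * b2 - y) ^+ 2 -
    ((b1 - x) ^+ 2 + (b2 - y) ^+ 2) =
    2 * e * ((b1 ^+ 2 + b2 ^+ 2) - (b1 * x + b2 * y)) +
    e ^+ 2 * (b1 ^+ 2 + b2 ^+ 2) by ring.
by rewrite bb addr_ge0// ?mulr_ge0// sqr_ge0.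
Qed.

(* The measures |f(r e^it)|^p dt put mass at most gamma on D as r -> 1; a
   continuous majorant replaces the indicator of D. *)
Definition small_mass p f (D : set R[i]) (gamma : R) :=
  exists (rho : R) (h : R -> R -> R), 0 <= rho < 1 /\
    forall r : R, rho < r < 1 -> [/\ continuous (h r), forall t, 0 <= h r t,
      circ (h r) <= gamma & forall t, D (expi t) ->
        normc (f (r%:C%C * expi t)) `^ p <= h r t].

Lemma small_massU p f (D E : set R[i]) (c d : R) :
  small_mass p f D c -> small_mass p f E d -> small_mass p f (D `|` E) (c + d).
Proof.
move=> [r1 [h1 [/andP[r10 r11] H1]]] [r2 [h2 [/andP[r20 r21] H2]]].
exists (Num.max r1 r2), (fun r t => h1 r t + h2 r t).
split=> [|r]; first by rewrite le_max r10/= gt_max r11.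
rewrite gt_max => /andP[/andP[r1r r2r] rlt].
have [c1 p1 i1 b1] := H1 r (introT andP (conj r1r rlt)).
have [c2 p2 i2 b2] := H2 r (introT andP (conj r2r rlt)).
split.
- by move=> t; apply: cvgD; [exact: c1|exact: c2].
- by move=> t; exact: addr_ge0.
- by rewrite circD// lerD.
- move=> t [/b1|/b2] /le_trans; apply; [by rewrite lerDl|by rewrite lerDr].
Qed.

(* G z = (b - z) / ((1 + eta) b - z) has modulus at most 1, vanishes at b and
   tends to 1 locally uniformly in the disc as eta -> 0.  Hence, for small eta,
   the mean of f G at some radius rho is almost the supremum of the means of f;
   as the means of f G increase, the means of f and f G stay close for all
   r > rho, which leaves little mass where |G| <= 1/2. *)
Lemma small_mass_point p f (A gamma : R) b : 1 <= p -> locally_expands disc f ->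
  (forall r : R, 0 <= r < 1 -> mean p f r <= A) -> normc b = 1 -> 0 < gamma ->
  exists2 e : R, 0 < e & small_mass p f (cball b e) gamma.
Proof.
move=> p1 fd fA b1 gamma0; have p0 : 0 < p by rewrite (lt_le_trans ltr01).
have A0 : 0 <= A by apply: le_trans (fA 0 _); rewrite ?mean_ge0// lexx ltr01.
(* A quarter of gamma is lost in approaching the supremum and another in replacing f by f G at rho;
   the factor 2 of the majorant doubles their sum. *)
pose g4 := gamma / 4; have g40 : 0 < g4 by rewrite divr_gt0.
pose M := [set mean p f r | r in [set r : R | 0 <= r < 1]].
have Msup : has_sup M.
  split; first by exists (mean p f 0), 0; rewrite //= lexx ltr01.
  by exists A => _ [r r01 <-]; exact: fA.
have [_ [rho /andP[rho0 rho1] <-] Mrho] := sup_adherent g40 Msup.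
have Mle (r : R) : 0 <= r < 1 -> mean p f r <= sup M.
  by move=> r01; apply: sup_upper_bound => //; exists r.
(* For |z| <= rho, 1 - |G z| <= eta / |beta - z| <= eta / (1 - rho) = x, so by Bernoulli's
   inequality the mean at rho loses at most p x (A + 1) <= gamma / 4. *)
pose x := Num.min 2^-1 (g4 / (p * (A + 1))).
have A1 : 0 < A + 1 by rewrite ltr_wpDl.
have x0 : 0 < x by rewrite lt_min invr_gt0 ltr0n/= divr_gt0// mulr_gt0.
have x1 : x <= 1 by rewrite ge_min invf_le1// ler1n.
pose eta := x * (1 - rho).
have eta0 : 0 < eta by rewrite mulr_gt0// subr_gt0.
pose beta := (1 + eta)%:C%C * b.
have nbeta : normc beta = 1 + eta.
  by rewrite /beta normcM b1 mulr1 normc_real gtr0_norm// addr_gt0.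
have beta_ge z (s : R) : normc z <= s -> 1 + eta - s <= normc (beta - z).
  move=> zs; rewrite lerBlDr -nbeta -{1}(subrK z beta).
  by rewrite (le_trans (normc_triangle _ _))// lerD2l.
have beta0 z : normc z <= 1 -> 0 < normc (beta - z).
  by move=> /beta_ge; rewrite addrAC subrr add0r; exact: lt_le_trans.
pose G z := (b - z) * (beta - z)^-1.
have nG z : normc z <= 1 -> normc (G z) <= 1.
  move=> z1; rewrite normcM normcV ler_pdivrMr ?beta0// mul1r.
  by apply: le_normc_outside => //; exact: ltW.
have fGd : locally_expands disc (fun z => f z * G z).
  apply: locally_expandsM => //; apply: locally_expandsM => c c1.
    exists 1 => //; apply: (@expands_ext _ _ _ (fun z => b + -1 * z)).
      by move=> z _; rewrite mulN1r.
    apply: expandsD; first exact: expands_cst.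
    apply: expandsZ; apply: (@expands_id _ _ _ (1 + normc c)).
      exact: cball_center.
    move=> z zc; rewrite -(subrK c z) (le_trans (normc_triangle _ _))//.
    by rewrite lerD2r ltW.
  have c10 : 0 < 1 - normc c by rewrite subr_gt0.
  exists (1 - normc c) => //.
  apply: (expands_inv eta0); first exact: cball_center.
  move=> z zc; have z1 : normc z <= 1.
    rewrite -(subrK c z) (le_trans (normc_triangle _ _))//.
    by rewrite -lerBrDr ltW.
  by have := beta_ge _ _ z1; rewrite addrAC subrr add0r.
have normfG z : normc (f z * G z) `^ p = normc (f z) `^ p * normc (G z) `^ p.
  by rewrite normcM powRM// normc_ge0.
have rn (r t : R) : 0 <= r -> normc (r%:C%C * expi t) = r.
  by move=> r0; rewrite normcM normc_real expi_norm mulr1 ger0_norm.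
have fc (r : R) : 0 <= r -> r < 1 ->
    continuous (fun t => normc (f (r%:C%C * expi t)) `^ p).
  by move=> r0 r1; apply: continuous_circle => //; exact: disc_locally_expands.
have fGc (r : R) : 0 <= r -> r < 1 ->
    continuous (fun t => normc (f (r%:C%C * expi t) * G (r%:C%C * expi t)) `^ p).
  move=> r0 r1; apply: (@continuous_circle _ p (fun z => f z * G z)) => //.
  exact: disc_locally_expands.
have rhoG : mean p f rho - g4 <= mean p (fun z => f z * G z) rho.
  apply: (@le_trans _ _ ((1 - p * x) * mean p f rho)).
    rewrite mulrBl mul1r lerD2l lerN2.
    apply: (@le_trans _ _ (p * x * (A + 1))).
      rewrite ler_wpM2l ?mulr_ge0 ?(ltW p0) ?(ltW x0)//.
      by rewrite (le_trans (fA _ _)) ?rho0// lerDl.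
    rewrite mulrAC mulrC -ler_pdivlMr ?mulr_gt0//.
    by rewrite ge_min lexx orbT.
  rewrite /mean -circZ; last exact: fc.
  apply: circ_le => [||t _]; [|exact: fGc|].
    by move=> t; apply: cvgM; [exact: cvg_cst|exact: fc].
  rewrite normfG mulrC ler_wpM2l ?powR_ge0//.
  apply: le_trans (powR_bernoulli p1 _) _; first by rewrite (ltW x0).
  apply: ge0_ler_powR; rewrite ?nnegrE ?subr_ge0 ?normc_ge0 ?(ltW p0)//.
  set z := _ * expi t; have zr : normc z <= rho by rewrite rn.
  have zb : 0 < normc (beta - z) by rewrite beta0// (le_trans zr)// ltW.
  rewrite normcM normcV ler_pdivlMr//.
  have h1 : normc (beta - z) - eta <= normc (b - z).
    rewrite lerBlDr -(subrKA b) addrC (le_trans (normc_triangle _ _))// lerD2l.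
    rewrite /beta -{2}[b]mul1r -mulrBl normcM b1 mulr1.
    by rewrite -[X in normc (_ - X)]/(1%:C%C) -rmorphB addrAC subrr add0r normc_real gtr0_norm.
  apply: le_trans h1; rewrite mulrBl mul1r lerD2l lerN2 /eta ler_wpM2l ?(ltW x0)//.
  by rewrite (le_trans _ (beta_ge _ _ zr))// addrAC lerDl ltW.
(* If both |e^it - b| and 1 - r are below eta / 4, then |b - z| <= eta / 2 <= |beta - z| / 2 at z =
   r e^it. Thus |G z|^p <= 1/2 there, and twice |f|^p - |f G|^p dominates |f|^p. *)
exists (eta / 4); first by rewrite divr_gt0.
exists (Num.max rho (1 - eta / 4)), (fun r t =>
  2 * (normc (f (r%:C%C * expi t)) `^ p -
       normc (f (r%:C%C * expi t) * G (r%:C%C * expi t)) `^ p)).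
split=> [|r]; first by rewrite le_max rho0/= gt_max rho1/= gtrBl divr_gt0.
rewrite gt_max => /andP[/andP[rhor etar] r1].
have r0 : 0 <= r by rewrite (le_trans rho0)// ltW.
have z1 t : normc (r%:C%C * expi t) <= 1 by rewrite rn// ltW.
have sc : continuous (fun t => normc (f (r%:C%C * expi t)) `^ p -
    normc (f (r%:C%C * expi t) * G (r%:C%C * expi t)) `^ p).
  by move=> t; apply: cvgB; [exact: fc|exact: fGc].
split.
- by move=> t; apply: cvgM; [exact: cvg_cst|exact: sc].
- move=> t; rewrite mulr_ge0// subr_ge0 normfG ler_piMr ?powR_ge0//.
  apply: (@le_trans _ _ (1 `^ p)); last by rewrite powR1.
  by rewrite ge0_ler_powR ?nnegrE ?normc_ge0 ?(ltW p0)// nG.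
- rewrite circZ// circB; [|exact: fc|exact: fGc].
  rewrite -/(mean p f r) -/(mean p (fun z => f z * G z) r).
  have h1 : mean p f r <= sup M by apply: Mle; rewrite r0.
  have h2 : mean p (fun z => f z * G z) rho <= mean p (fun z => f z * G z) r.
    by apply: mean_le => //; [exact: ltW|exact: disc_locally_expands].
  have gE : gamma = 4 * g4 by rewrite /g4 mulrC divfK.
  rewrite gE; move: h1 h2 Mrho rhoG.
  move: (mean p f r) (sup M) (mean p f rho) (mean p _ r) (mean p _ rho).
  by clear => m1 m2 m3 m4 m5 h1 h2 h3 h4; lra.
- move=> t tb; rewrite normfG.
  set z := _ * expi t; set u := normc (f z) `^ p.
  have u0 : 0 <= u by exact: powR_ge0.
  have Gz : normc (G z) <= 2^-1.
    have zb : eta <= normc (beta - z).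
      by have := beta_ge _ _ (z1 t); rewrite addrAC subrr add0r.
    rewrite normcM normcV ler_pdivrMr; last exact: lt_le_trans zb.
    apply: (@le_trans _ _ (eta / 2)); last first.
      by rewrite mulrC ler_wpM2l// invr_ge0.
    rewrite -(subrKA (expi t)) (le_trans (normc_triangle _ _))//.
    have -> : eta / 2 = eta / 4 + eta / 4 by field.
    rewrite lerD//; first by rewrite normcB ltW.
    rewrite /z -{1}[expi t]mul1r -mulrBl normcM expi_norm mulr1.
    rewrite -[X in normc (X - _)]/(1%:C%C) -rmorphB normc_real.
    by rewrite ger0_norm ?subr_ge0 ?(ltW r1)// lerBlDr -lerBlDl ltW.
  have Gp : normc (G z) `^ p <= 2^-1.
    have := normc_ge0 (G z); rewrite le_eqVlt => /predU1P[<-|G0].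
      by rewrite powR0 ?gt_eqF// invr_ge0.
    apply: le_trans Gz; apply: ge1r_powR => //; rewrite G0/=; exact: nG (z1 t).
  have := ler_wpM2l u0 Gp; clearbody u; move: (u * _) => v uv.
  by clear -uv; lra.
Qed.

Lemma small_mass_seq p f (A gamma : R) (l : seq R[i]) : 1 <= p ->
  locally_expands disc f -> (forall r : R, 0 <= r < 1 -> mean p f r <= A) ->
  (forall b, b \in l -> normc b = 1) -> 0 < gamma ->
  exists2 e : R, 0 < e &
    small_mass p f [set w | exists2 b, b \in l & cball b e w] gamma.
Proof.
move=> p1 fd fA; elim: l gamma => [|b l IH] gamma l1 gamma0.
  exists 1 => //; exists 0, (fun _ _ => 0); rewrite lexx ltr01; split=> // r _.
  split=> //; first exact: cst_continuous.
  - by rewrite /circ /Rintegral integral0//= ltW.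
  - by move=> t [b].
have g2 : 0 < gamma / 2 by rewrite divr_gt0.
have [|e1 e10 small1] := IH _ _ g2.
  by move=> c cl; apply: l1; rewrite inE cl orbT.
have b1 : normc b = 1 by apply: l1; rewrite inE eqxx.
have [e2 e20 small2] := small_mass_point p1 fd fA b1 g2.
exists (Num.min e1 e2); first by rewrite lt_min e10.
have := small_massU small1 small2; rewrite -splitr.
move=> [rho [h [rho01 H]]]; exists rho, h; split=> // r /H[hc h0 hg hf].
split=> // t [c]; rewrite inE => /predU1P[->|cl]; rewrite /cball/= lt_min => /andP[t1 t2].
  by apply: hf; right.
by apply: hf; left; exists c.
Qed.

End NoAtom.

(** * Decay of psi phi^k *)

Section Decay.
Context {R : realType}.
Implicit Types (phi psi : R[i] -> R[i]) (a w z : R[i]) (p : R).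

Lemma normc_circle_le1 phi a : (forall z, disc z -> disc (phi z)) ->
  (forall w, normc w = 1 -> w != a -> {for w, continuous phi}) ->
  forall w, normc w = 1 -> w != a -> normc (phi w) <= 1.
Proof.
move=> phid phic w w1 wa; rewrite leNgt; apply/negP => phiw.
have e0 : 0 < normc (phi w) - 1 by rewrite subr_gt0.
have /(cvg_normcP (nbhs_filter w))/(_ _ e0)/nbhs_ballP[d /gt0_complexE[d0 dE] h] :=
  phic w w1 wa.
pose x := Num.min 2^-1 (complex.Re d / 2).
have x0 : 0 < x by rewrite lt_min invr_gt0 ltr0n/= divr_gt0.
have xd : x < complex.Re d.
  by rewrite gt_min ltr_pdivrMr// ltr_pMr// ltr1n orbT.
have x1 : x < 1 by rewrite gt_min invf_lt1// ltr1n.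
pose z := (1 - x)%:C%C * w.
have /phid : disc z.
  rewrite /disc /mkset /z normcM w1 mulr1 normc_real ger0_norm ?gtrBl//.
  by rewrite subr_ge0 ltW.
have /h : ball w d z.
  rewrite -ball_normE /ball_/= dE normrE_normc ltcR /z -{1}[w]mul1r -mulrBl.
  rewrite -[X in X - _]/(1%:C%C) -rmorphB normcM w1 mulr1 normc_real.
  by rewrite subKr gtr0_norm.
rewrite /disc /mkset => h1 h2.
have := normc_triangle (phi w - phi z) (phi z); rewrite subrK.
move: h1 h2; move: (normc (phi w - _)) (normc (phi w)) (normc (phi z)).
by clear => ? ? ? h1 h2; lra.
Qed.

Lemma continuous_dist_expi w : continuous (fun t : R => normc (expi t - w)).
Proof.
move=> t; apply: (@continuous_comp _ _ _ (fun t => expi t - w)); last first.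
  exact: continuous_normc.
by apply: cvgB; [exact: continuous_expi|exact: cvg_cst].
Qed.

Lemma closed_dist_expi w (e : R) : closed [set t : R | e <= normc (expi t - w)].
Proof.
have -> : [set t : R | e <= normc (expi t - w)] =
  (fun t => normc (expi t - w)) @^-1` [set x : R | e <= x] by [].
by apply: preimage_closed; [move=> t _; exact: continuous_dist_expi|exact: closed_ge].
Qed.

Lemma compact_angles (D : seq R[i]) (e : R) : compact [set t : R |
  0 <= t <= 2 * pi /\ forall w, w \in D -> e <= normc (expi t - w)].
Proof.
have -> : [set t : R | 0 <= t <= 2 * pi /\ forall w, w \in D -> e <= normc (expi t - w)]
  = `[0, 2 * pi]%classic `&` \bigcap_(w in [set` D]) [set t | e <= normc (expi t - w)].
  by apply/seteqP; split=> t /=; rewrite in_itv.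
apply: compact_closedI; first exact: segment_compact.
by apply: closed_bigI => w _; exact: closed_dist_expi.
Qed.

(** One d is both the width of the collar and the gap below 1: each demand weakens as d decreases,
    so compactness yields a common value. *)
Lemma uniform_bound phi (K : set R) : compact K ->
  (forall t, K t -> {for expi t, continuous phi} /\ normc (phi (expi t)) < 1) ->
  exists2 d : R, 0 < d < 1 & forall (t r : R), K t -> 1 - d < r < 1 ->
    normc (phi (r%:C%C * expi t)) <= 1 - d.
Proof.
move=> Kc Kphi.
move: Kc; rewrite compact_near_coveringP => /(_ R 0^'+ (fun d t => forall r : R,
  1 - d < r < 1 -> normc (phi (r%:C%C * expi t)) <= 1 - d)).
case.
- move=> t /Kphi[phic phi1].
  pose e := (1 - normc (phi (expi t))) / 2.
  have e0 : 0 < e by rewrite divr_gt0// subr_gt0.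
  have /(cvg_normcP (nbhs_filter (expi t)))/(_ _ e0)/nbhs_ballP[d /gt0_complexE[d0 dE] h]
    := phic.
  set q := complex.Re d in d0 dE; have q2 : 0 < q / 2 by rewrite divr_gt0.
  near=> s x => /= r /andP[xr r1].
  have xe : x <= e by near: x; exact: nbhs_right_le.
  have xq : x <= q / 2 by near: x; exact: nbhs_right_le.
  have sq : normc (expi t - expi s) < q / 2.
    near: s; have := @continuous_expi R t.
    by move=> /(cvg_normcP (nbhs_filter t)); exact.
  have /h : ball (expi t) d (r%:C%C * expi s).
    rewrite -ball_normE /ball_/= dE normrE_normc ltcR -(subrKA (expi s)).
    rewrite (le_lt_trans (normc_triangle _ _))// [ltRHS]splitr ltr_leD//.
    rewrite -{1}[expi s]mul1r -mulrBl normcM expi_norm mulr1.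
    rewrite -[X in X - _]/(1%:C%C) -rmorphB normc_real ger0_norm ?subr_ge0 ?ltW//.
    by rewrite (lt_le_trans _ xq)// ltrBlDr -ltrBlDl.
  rewrite /mkset; have := normc_dist (phi (expi t)) (phi (r%:C%C * expi s)).
  rewrite ler_norml => /andP[+ _] => h1 h2.
  move: h1 h2 xe; rewrite /e; move: (normc (phi (expi t))) (normc _) (normc _).
  by clear => *; lra.
- move=> d /= d0 h.
  pose m := Num.min d 1 / 2.
  have m0 : 0 < m by rewrite divr_gt0// lt_min d0 ltr01.
  have md : m < Num.min d 1 by rewrite ltr_pdivrMr ?ltr_pMr ?ltr1n ?lt_min ?d0 ?ltr01.
  exists m; first by rewrite m0 (lt_le_trans md)// ge_min lexx orbT.
  move=> t r Kt; apply: (h m) => //=.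
  by rewrite sub0r normrN gtr0_norm// (lt_le_trans md)// ge_min lexx.
Unshelve. all: by end_near. Qed.

Lemma expr_small (q e : R) : 0 <= q < 1 -> 0 < e -> exists k, q ^+ k <= e.
Proof.
move=> /andP[q0 q1] e0.
have q1' : `|q| < 1 by rewrite ger0_norm.
have /cvgrPdist_lt/(_ _ e0)[N _ /(_ N (leqnn N))] := cvg_expr q1'.
rewrite /= sub0r normrN => /ltW h; exists N; apply: le_trans h; exact: ler_norm.
Qed.

Lemma mean_mulX_small p psi phi (A gamma : R) a :
  1 <= p -> locally_expands disc psi ->
  (forall r : R, 0 <= r < 1 -> mean p psi r <= A) ->
  locally_expands disc phi -> (forall z, disc z -> disc (phi z)) ->
  normc a = 1 ->
  (forall w, normc w = 1 -> w != a -> {for w, continuous phi}) ->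
  (forall w, normc w = 1 -> w != a -> exists2 r : R, 0 < r &
     forall z, normc z = 1 -> normc (z - w) < r -> z != w -> normc (phi z) != 1) ->
  0 < gamma ->
  exists k (rho : R), 0 <= rho < 1 /\ forall r : R, rho < r < 1 ->
    mean p (fun z => psi z * phi z ^+ k) r <= gamma.
Proof.
move=> p1 psid psiA phid phidisc a1 phic iso gamma0.
have p0 : 0 < p by rewrite (lt_le_trans ltr01).
have A0 : 0 <= A by apply: le_trans (psiA 0 _); rewrite ?mean_ge0// lexx ltr01.
have A1 : 0 < A + 1 by rewrite ltr_wpDl.
(* One third for the arc near a, one for the arcs near finitely many other points, and one for the
   rest of the circle, where |phi|^k is small. *)
have g3 : 0 < gamma / 3 by rewrite divr_gt0.
have phi1 := normc_circle_le1 phidisc phic.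
have [e e0 smalla] := small_mass_point p1 psid psiA a1 g3.
pose K := [set t : R | 0 <= t <= 2 * pi /\ forall w, w \in [:: a] -> e <= normc (expi t - w)].
have Ka t : K t -> expi t != a.
  move=> [_ /(_ a)]; rewrite inE eqxx => /(_ isT); apply: contraTneq => ->.
  by rewrite subrr normc0 -ltNge.
have : compact K by exact: compact_angles.
(* Each angle t of K has a neighbourhood in which |phi| = 1 can hold only at the point e^it. Hence
   every point with |phi| = 1 and angle in K is the centre of a member of the finite subcover. *)
rewrite compact_cover => /(_ R K (fun t => interior [set s |
  normc (phi (expi s)) = 1 -> expi s = expi t])).
case=> [t _|t Kt|D DK KD]; first exact: open_interior.
  exists t => //; have [r r0 h] := iso _ (expi_norm t) (Ka _ Kt).
  have /(cvg_normcP (nbhs_filter t))/(_ _ r0) := @continuous_expi R t.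
  apply: filterS => s; rewrite normcB => sr phis; apply/eqP/negPn/negP => st.
  by have /eqP := h _ (expi_norm s) sr st.
pose l := [seq expi t | t <- finmap.enum_fset D].
have l1 b : b \in l -> normc b = 1 by move=> /mapP[t _ ->]; exact: expi_norm.
have [e' e'0 smalll] := small_mass_seq p1 psid psiA l1 g3.
pose K' := K `&` [set t : R | 0 <= t <= 2 * pi /\
  forall w, w \in l -> e' <= normc (expi t - w)].
have [||d /andP[d0 d1] phid1] := @uniform_bound phi K'.
- apply: compact_closedI; first exact: compact_angles.
  by apply: compact_closed; [exact: norm_hausdorff|exact: compact_angles].
- move=> t [Kt [_ tl]]; have ta := Ka t Kt.
  split; first by apply: phic => //; exact: expi_norm.
  rewrite lt_neqAle phi1 ?expi_norm// andbT; apply/eqP => phit.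
  have [s sD /interior_subset/(_ phit) ts] := KD t Kt.
  have : expi t \in l by apply/mapP; exists s.
  by move=> /tl; rewrite subrr normc0 leNgt e'0.
have [k qk] : exists k, (1 - d) ^+ k <= gamma / 3 / (A + 1).
  apply: expr_small; last by rewrite !divr_gt0.
  by rewrite subr_ge0 (ltW d1) gtrBl.
have [rho [h [/andP[rho0 rho1] H]]] := small_massU smalla smalll.
exists k, (Num.max rho (1 - d)); split=> [|r].
  by rewrite le_max rho0/= gt_max rho1/= gtrBl.
rewrite gt_max => /andP[/andP[rhor dr] r1].
have r0 : 0 <= r by rewrite (le_trans rho0)// ltW.
have [hc h0 hg hb] := H r (introT andP (conj rhor r1)).
have rn t : normc (r%:C%C * expi t) = r.
  by rewrite normcM normc_real expi_norm mulr1 ger0_norm.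
have psic : continuous (fun t => normc (psi (r%:C%C * expi t)) `^ p).
  by apply: continuous_circle => //; exact: disc_locally_expands.
have phik : locally_expands disc (fun z => phi z ^+ k).
  move=> c /phid[s s0 ps]; exists s => //; apply: expandsX => //.
  exact: cball_center.
have cc : continuous (fun t => normc (psi (r%:C%C * expi t) * phi (r%:C%C * expi t) ^+ k) `^ p).
  apply: (@continuous_circle _ p (fun z => psi z * phi z ^+ k)) => //.
  by apply: disc_locally_expands => //; exact: locally_expandsM.
pose q := (1 - d) ^+ k.
have q0 : 0 <= q by rewrite exprn_ge0// subr_ge0 ltW.
have qc : continuous (fun t => q * normc (psi (r%:C%C * expi t)) `^ p).
  by move=> t; apply: cvgM; [exact: cvg_cst|exact: psic].
apply: (@le_trans _ _ (circ (fun t => h r t + q * normc (psi (r%:C%C * expi t)) `^ p))).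
  apply: circ_le => // [t|t t2]; first by apply: cvgD; [exact: hc|exact: qc].
  rewrite normcM normcX powRM ?exprn_ge0 ?normc_ge0//.
  set z := _ * expi t; set u := normc (psi z) `^ p.
  have u0 : 0 <= u by exact: powR_ge0.
  have phiz : normc (phi z) <= 1.
    by apply/ltW/phidisc; rewrite /disc /mkset rn.
  have pk1 : normc (phi z) ^+ k <= 1 by rewrite exprn_ile1// normc_ge0.
  have pk0 : 0 <= normc (phi z) ^+ k by rewrite exprn_ge0// normc_ge0.
  have pkp : (normc (phi z) ^+ k) `^ p <= normc (phi z) ^+ k.
    move: pk0; rewrite le_eqVlt => /predU1P[<-|pk0]; first by rewrite powR0 ?gt_eqF.
    by apply: ge1r_powR => //; rewrite pk0.
  have [tD|tD] := pselect ((cball a e `|` [set w | exists2 b, b \in l & cball b e' w]) (expi t)).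
    have := hb t tD; rewrite -/z -/u => uh.
    apply: (@le_trans _ _ u); last by rewrite (le_trans uh)// lerDl mulr_ge0.
    by rewrite ler_piMr// (le_trans pkp).
  have qz : normc (phi z) <= 1 - d.
    apply: phid1; last by rewrite dr r1.
    split; split=> // w; last first.
      by move=> wl; rewrite leNgt; apply/negP => tw; apply: tD; right; exists w.
    by rewrite inE => /eqP->; rewrite leNgt; apply/negP => ta; apply: tD; left.
  apply: (@le_trans _ _ (q * u)); last by rewrite lerDr.
  rewrite mulrC ler_wpM2r// (le_trans pkp)// /q lerXn2r ?nnegrE ?normc_ge0//.
  by rewrite subr_ge0 ltW.
rewrite circD// circZ// -/(mean p psi r).
have -> : gamma = gamma / 3 + gamma / 3 + gamma / 3 by field.
rewrite lerD//; apply: (@le_trans _ _ (q * (A + 1))).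
  by rewrite ler_wpM2l// (le_trans (psiA _ _)) ?r0// lerDl.
by rewrite -ler_pdivlMr.
Qed.

End Decay.

(** * The points of the circle with |phi| = 1 *)

Section Alternative.
Context {R : realType}.
Implicit Types (phi : R[i] -> R[i]) (a w z : R[i]).

Lemma expi_neq0 (t : R) : expi t != 0.
Proof. by rewrite -normc_gt0 expi_norm ltr01. Qed.

Lemma expiB_eq1 (s t : R) : expi s = expi t -> expi (s - t) = 1.
Proof.
by move=> st; apply: (mulIf (expi_neq0 t)); rewrite -expiD subrK mul1r.
Qed.

Lemma expi_eq1_pi (x : R) : 0 <= x <= pi -> expi x = 1 -> x = 0.
Proof.
move=> /andP[x0 xpi] [cx _]; apply: cos_inj; rewrite ?cos0// in_itv/= ?x0//.
by rewrite lexx pi_ge0.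
Qed.

Lemma expi_eq1_2pi (x : R) : 0 <= x <= 2 * pi -> expi x = 1 ->
  x = 0 \/ x = 2 * pi.
Proof.
move=> /andP[x0 x2] ex; have [xpi|xpi] := leP x pi.
  by left; apply: expi_eq1_pi => //; rewrite x0.
right; have : 2 * pi - x = 0.
  apply: expi_eq1_pi; first rewrite subr_ge0 x2/= lerBlDr mulr_natl mulr2n lerD2l.
    exact: ltW.
  by apply: expiB_eq1; rewrite ex -[2 * pi]add0r expi_2pi /expi cos0 sin0.
by move=> /eqP; rewrite subr_eq0 => /eqP ->.
Qed.

Lemma angle_surj (alpha : R) w : 0 <= alpha <= 2 * pi -> normc w = 1 ->
  w != expi alpha -> exists2 t : R, alpha < t < alpha + 2 * pi & w = expi t.
Proof.
move=> /andP[a0 a2] w1 wa; have [t /andP[t0 t2]] := polar w.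
rewrite w1 mul1r => wE; have [ta|ta|ta] := ltgtP t alpha.
- exists (t + 2 * pi); last by rewrite expi_2pi.
  rewrite ltrD2r ta andbT lt_neqAle (le_trans a2) ?lerDr// andbT.
  by apply: contra wa => /eqP ->; rewrite expi_2pi -wE.
- exists t => //; rewrite ta lt_neqAle (le_trans t2) ?lerDr// andbT.
  by apply: contra wa; rewrite wE => /eqP ->; rewrite expi_2pi.
- by move: wa; rewrite wE ta eqxx.
Qed.

Lemma angle_neq (alpha t : R) : alpha < t < alpha + 2 * pi -> expi t != expi alpha.
Proof.
move=> /andP[at_ t2]; apply/eqP => /expiB_eq1 e1.
have x0 : 0 < t - alpha by rewrite subr_gt0.
have x2 : t - alpha < 2 * pi by rewrite ltrBlDl.
have [] := expi_eq1_2pi _ e1; first by rewrite !ltW.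
  by move=> /eqP; rewrite gt_eqF.
by move=> /eqP; rewrite lt_eqF.
Qed.

(* The points of the open arc around which |phi| = 1 form a subset that is open
   and, by the local dichotomy, relatively closed. *)
Lemma unimodular_alternative phi a : normc a = 1 ->
  (forall w, normc w = 1 -> w != a -> analytic_at phi w) ->
  (forall w, normc w = 1 -> w != a -> normc (phi w) = 1) \/
  (forall w, normc w = 1 -> w != a -> exists2 r : R, 0 < r & forall z,
     normc z = 1 -> normc (z - w) < r -> z != w -> normc (phi z) != 1).
Proof.
move=> a1 phian.
pose loc1 w := exists2 r : R, 0 < r & forall z, normc z = 1 -> normc (z - w) < r ->
  normc (phi z) = 1.
have [[w0 [w01 w0a w0loc]]|no] := pselect (exists w, [/\ normc w = 1, w != a & loc1 w]);
    last first.
  right=> w w1 wa; have [h|[r r0 h]] := unimodular_dichotomy w1 (phian w w1 wa).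
    by exfalso; apply: no; exists w.
  by exists r.
left; have [alpha alpha2] := polar a; rewrite a1 mul1r => aE.
pose S := [set t : R | normc (phi (expi t)) = 1].
pose I := `]alpha, alpha + 2 * pi[%classic.
have near_expi (t r : R) : 0 < r -> \forall s \near t, normc (expi s - expi t) < r.
  move=> r0; have /(cvg_normcP (nbhs_filter t))/(_ _ r0) := @continuous_expi R t.
  by apply: filterS => s; rewrite normcB.
have locS t : loc1 (expi t) -> interior S t.
  move=> [r r0 h]; apply: filterS (near_expi t r r0) => s; apply: h.
  exact: expi_norm.
have Iconn : connected I by apply/connected_intervalP/interval_is_interval.
suff SI : I `&` interior S = I.
  move=> w w1; rewrite aE => wa; have [t tI ->] := angle_surj alpha2 w1 wa.
  have : I t by rewrite /I/= in_itv.
  by rewrite -SI => -[_ /interior_subset].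
apply: Iconn.
- move: w0a w0loc; rewrite aE => w0a.
  have [t tI ->] := angle_surj alpha2 w01 w0a => /locS tS.
  by exists t; split=> //; rewrite /I/= in_itv.
- by exists (interior S); [exact: open_interior|].
- exists (closure (interior S)); first exact: closed_closure.
  apply/seteqP; split=> t [It tS]; split=> //; first exact: subset_closure.
  have ta : expi t != a by rewrite aE; apply: angle_neq; move: It; rewrite /I/= in_itv.
  have [/locS//|[r r0 h]] := unimodular_dichotomy (expi_norm t) (phian _ (expi_norm t) ta).
  have [s [sS st]] := tS _ (near_expi t r r0).
  (* If e^it were isolated among the points with |phi| = 1, then e^iu = e^it for all u near s. This
     contradicts the injectivity of e^iu on short intervals, tested at s and s + x with 0 < x <
     pi. *)
  have : \forall u \near s, normc (phi (expi u)) = 1 /\ normc (expi u - expi t) < r.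
    apply: filterS2 sS (near_expi s (r - normc (expi s - expi t)) _).
      move=> u Su us; split=> //; rewrite -(subrKA (expi s)).
      by rewrite (le_lt_trans (normc_triangle _ _))// -ltrBrDr.
    by rewrite subr_gt0.
  have near_eq u : normc (phi (expi u)) = 1 /\ normc (expi u - expi t) < r ->
      expi u = expi t.
    move=> [u1 ur]; apply/eqP/negPn/negP => ut.
    by have := h _ (expi_norm u) ur ut; rewrite u1 eqxx.
  move=> su; have sE := near_eq _ (nbhs_singleton su).
  move: su => /nbhs_ballP[d /= d0 dsu].
  pose x := Num.min d 1 / 2.
  have m0 : 0 < Num.min d 1 by rewrite lt_min d0 ltr01.
  have x0 : 0 < x by rewrite divr_gt0.
  have xm : x < Num.min d 1 by rewrite ltr_pdivrMr// ltr_pMr// ltr1n.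
  have /near_eq : normc (phi (expi (s + x))) = 1 /\ normc (expi (s + x) - expi t) < r.
    apply: dsu; rewrite -ball_normE /ball_/= opprD addrA subrr sub0r normrN gtr0_norm//.
    by rewrite (lt_le_trans xm)// ge_min lexx.
  rewrite -sE => /expiB_eq1; rewrite addrC addKr => /expi_eq1_pi xE.
  have := x0; rewrite xE ?ltxx// (ltW x0)/=.
  rewrite (le_trans (ltW xm))// (@le_trans _ _ 1)//; first by rewrite ge_min lexx orbT.
  by rewrite (le_trans _ (pi_ge2 R))// ler1n.
Qed.

End Alternative.

(** * Monomials in the Hardy space *)

Section Hardy.
Context {R : realType} {p : R} {p1 : 1 <= p}.
Local Notation H := (hardy p1).
Implicit Types (f : R[i] -> R[i]) (r : R).

Lemma analytic_on_locally_expands (U : set R[i]) f : analytic_on U f ->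
  locally_expands U f.
Proof. by move=> fU c /fU; exact: analytic_expands. Qed.

Lemma integral_meanE f r : 0 <= r < 1 -> locally_expands disc f ->
  integral_mean p f r = ((2 * pi)^-1 * mean p f r)%:E.
Proof.
move=> /andP[r0 r1] fd; rewrite /integral_mean /circle_integral circ_EFin//.
by apply: continuous_circle => //; exact: disc_locally_expands.
Qed.

(** Means increase with the radius, so a bound valid only near the circle controls the supremum over
    all radii. *)
Lemma hardy_mean_le f (rho M : R) : locally_expands disc f -> 0 <= rho < 1 ->
  (forall r, rho < r < 1 -> mean p f r <= M) ->
  (hardy_mean p f <= ((2 * pi)^-1 * M)%:E)%E.
Proof.
move=> fd /andP[rho0 rho1] fM; apply: ge_ereal_sup => _ [r /= + <-].
rewrite in_itv/= => /andP[r0 r1].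
rewrite integral_meanE ?(ltW r0)// lee_fin ler_wpM2l ?invr_ge0 ?(ltW pi2_gt0)//.
pose s := (Num.max r rho + 1) / 2.
have m1 : Num.max r rho < 1 by rewrite gt_max r1.
have ms : Num.max r rho < s by rewrite /s midf_lt.
have s1 : s < 1 by rewrite /s midf_lt.
have rs : r <= s by rewrite (le_trans _ (ltW ms))// le_max lexx.
apply: (@le_trans _ _ (mean p f s)).
  by apply: mean_le => //; [exact: ltW|exact: disc_locally_expands].
by apply: fM; rewrite s1 (le_lt_trans _ ms)// le_max lexx orbT.
Qed.

Lemma circ_cst (k : R) : circ (fun=> k) = k * (2 * pi).
Proof.
rewrite /circ Rintegral_cst//; congr (_ * _).
have := @lebesgue_measure_itv R `[0, 2 * pi]; rewrite /= lte_fin pi2_gt0 oppr0 adde0.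
by move=> /(congr1 fine).
Qed.

Definition monomial (k : nat) (z : R[i]) : R[i] :=
  if normc z < 1 then z ^+ k else 0.

Lemma monomial_analytic k : analytic_on disc (monomial k).
Proof.
move=> c c1; have c10 : 0 < 1 - normc c by rewrite subr_gt0.
have inball z : cball c (1 - normc c) z -> normc z < 1.
  move=> zc; rewrite -(subrK c z) (le_lt_trans (normc_triangle _ _))//.
  by rewrite -ltrBrDr.
have cc : cball c (1 - normc c) c by exact: cball_center.
apply: (expands_analytic c10); apply: (@expands_ext _ _ _ (fun z => z ^+ k)).
  by move=> z zc; rewrite /monomial inball.
by apply: expandsX => //; apply: (@expands_id _ _ _ 1) => // z /inball/ltW.
Qed.

Lemma mean_monomial k r : 0 <= r < 1 ->
  mean p (monomial k) r = (r ^+ k) `^ p * (2 * pi).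
Proof.
move=> /andP[r0 r1]; rewrite /mean -circ_cst; congr circ; apply/funext => t.
have rn : normc (r%:C%C * expi t) = r.
  by rewrite normcM normc_real expi_norm mulr1 ger0_norm.
by rewrite /monomial rn r1 normcX rn.
Qed.

Lemma hardy_mean_monomial_le k : (hardy_mean p (monomial k) <= 1)%E.
Proof.
have -> : (1 = ((2 * pi)^-1 * (2 * pi))%:E :> \bar R)%E.
  by rewrite mulVf// gt_eqF// pi2_gt0.
have p0 : 0 < p by rewrite (lt_le_trans ltr01).
apply: (@hardy_mean_le _ 0); rewrite ?lexx ?ltr01//.
  by apply: analytic_on_locally_expands; exact: monomial_analytic.
move=> r /andP[r0 r1]; rewrite mean_monomial ?(ltW r0)//.
rewrite ler_piMl ?(ltW pi2_gt0)//; apply: (@le_trans _ _ (1 `^ p)); last by rewrite powR1.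
rewrite ge0_ler_powR ?nnegrE ?exprn_ge0 ?(ltW p0) ?(ltW r0)//.
by rewrite exprn_ile1 ?ltW.
Qed.

(** Any positive bound independent of k would do. With x = 1 / (2 p (k + 1)) and r = 1 - x, two
    Bernoulli inequalities give (r^k)^p >= (1 - k x)^p >= 1 - p k x >= 1/2. *)
Lemma hardy_mean_monomial_ge k : (2^-1%:E <= hardy_mean p (monomial k))%E.
Proof.
have p0 : 0 < p by rewrite (lt_le_trans ltr01).
pose x := (2 * p * k.+1%:R)^-1.
have x0 : 0 < x by rewrite invr_gt0 !mulr_gt0.
have px : p * (k%:R * x) <= 2^-1.
  rewrite /x mulrA ler_pdivrMr ?mulr_gt0//.
  have -> : 2^-1 * (2 * p * k.+1%:R) = p * k.+1%:R by field.
  by rewrite ler_wpM2l ?(ltW p0)// ler_nat.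
have x1 : x < 1.
  rewrite invf_lt1 ?mulr_gt0//; apply: (@lt_le_trans _ _ 2); first by rewrite ltr1n.
  by rewrite -[leLHS]mulr1 -mulrA ler_wpM2l// -[leLHS]mulr1 ler_pM// ler1n.
pose r := 1 - x.
have r01 : 0 < r < 1 by rewrite subr_gt0 x1 gtrBl.
have /andP[r0 r1] := r01.
have bern j : 1 - j%:R * x <= r ^+ j.
  elim: j => [|j IH]; first by rewrite mul0r subr0 expr0.
  rewrite exprS -natr1.
  have : (1 - j%:R * x) * r <= r ^+ j * r by rewrite ler_wpM2r// ltW.
  rewrite mulrC [r ^+ j * r]mulrC; apply: le_trans.
  rewrite /r -subr_ge0 (_ : _ - _ = j%:R * x * x); last by ring.
  by rewrite !mulr_ge0// ltW.
apply: (@le_trans _ _ (integral_mean p (monomial k) r)); last first.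
  by apply: ereal_sup_ubound; exists r => //=; rewrite in_itv.
rewrite integral_meanE ?(ltW r0)//; last first.
  by apply: analytic_on_locally_expands; exact: monomial_analytic.
rewrite lee_fin mean_monomial ?(ltW r0)// mulrC mulfK ?gt_eqF ?pi2_gt0//.
have kx : 0 <= k%:R * x by rewrite mulr_ge0// ltW.
have kx1 : k%:R * x <= 1.
  apply: (@le_trans _ _ (p * (k%:R * x))); first by rewrite ler_peMl.
  by rewrite (le_trans px)// invf_le1// ler1n.
apply: (@le_trans _ _ ((1 - k%:R * x) `^ p)); last first.
  by apply: ge0_ler_powR; rewrite ?nnegrE ?subr_ge0 ?exprn_ge0 ?(ltW r0) ?(ltW p0).
apply: le_trans (powR_bernoulli p1 _); last by rewrite kx.
by move: px; move: (p * _) => y; clear; lra.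
Qed.

Lemma monomial_hardy k : monomial k \in hardy_pred p1.
Proof.
apply/hardy_predP; split; first exact: monomial_analytic.
- by move=> z; rewrite /disc /mkset /monomial; case: ifP.
- by rewrite (le_lt_trans (hardy_mean_monomial_le k))// ltry.
Qed.

Definition hardy_monomial k : H := Hardy (monomial_hardy k).

Lemma hardy_norm_ge0 (f : H) : 0 <= hardy_norm f.
Proof. exact: powR_ge0. Qed.

(** Since S T = U S, ||f|| <= M' ||S f|| = M' ||U S f|| = M' ||S T f|| <= M' M ||T f||. The
    constants in [bounded_operator] carry no sign, hence the maxima with 0. *)
Lemma similar_to_isometry_bounded_below (T : {linear H -> H}) :
  similar_to_isometry T ->
  exists2 C : R, 0 <= C & forall f : H, hardy_norm f <= C * hardy_norm (T f).
Proof.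
move=> [_ [S [S' [U [[[M SM] [M' S'M] SK S'K] [Uiso TE]]]]]].
exists (Num.max 0 M' * Num.max 0 M); first by rewrite mulr_ge0// le_max lexx.
move=> f; have := S'M (S f); rewrite SK => /le_trans; apply.
apply: (@le_trans _ _ (Num.max 0 M' * hardy_norm (S f))).
  by apply: ler_wpM2r; [exact: hardy_norm_ge0|rewrite le_max lexx orbT].
rewrite -mulrA; apply: ler_wpM2l; first by rewrite le_max lexx.
rewrite -(Uiso (S f)).
have <- : S (T f) = U (S f) by rewrite TE/= S'K.
apply: le_trans (SM (T f)) _.
by apply: ler_wpM2r; [exact: hardy_norm_ge0|rewrite le_max lexx orbT].
Qed.

Lemma hardy_mean_bound (f : H) : exists A : R, forall r, 0 <= r < 1 -> mean p f r <= A.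
Proof.
have [fan _ fM] := (hardy_predP p1 f).1 (hardyP f).
have fd := analytic_on_locally_expands fan.
exists (2 * pi * fine (hardy_mean p f)) => r /andP[r0 r1].
pose s := (r + 1) / 2.
have rs : r < s by rewrite /s midf_lt.
have s1 : s < 1 by rewrite /s midf_lt.
have s0 : 0 < s by rewrite (le_lt_trans r0).
apply: (@le_trans _ _ (mean p f s)).
  by apply: mean_le => //; [exact: ltW|exact: disc_locally_expands].
have : (integral_mean p f s <= hardy_mean p f)%E.
  by apply: ereal_sup_ubound; exists s => //=; rewrite in_itv/= s0.
rewrite integral_meanE ?(ltW s0)//.
case: (hardy_mean p f) fM => [x _|//|//].
by rewrite lee_fin /= mulrC ler_pdivrMr ?pi2_gt0// mulrC.
Qed.

End Hardy.

(** * Radial limits and the final contradiction *)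

Lemma ae_circle_neq (R : realType) (a : R[i]) (P : R[i] -> Prop) :
  normc a = 1 -> (forall w, normc w = 1 -> w != a -> P w) -> circle_ae P.
Proof.
move=> a1 aP; have [alpha /andP[alpha0 alpha2]] := polar a; rewrite a1 mul1r => aE.
(* Two angles in [0, 2 pi] that give the same point differ by -2 pi, 0 or 2 pi. *)
pose N := [set alpha - 2 * pi; alpha] `|` [set alpha + 2 * pi].
have set10 (x : R) : (@lebesgue_measure R).-negligible [set x].
  by apply/negligibleP; [exact: measurable_set1|exact: lebesgue_measure_set1].
have N0 : (@lebesgue_measure R).-negligible N by do 2 apply: negligibleU => //.
apply: negligibleS N0 => t /= nP; apply: contrapT => tN; apply: nP.
rewrite in_itv/= => /andP[t0 t2]; apply: aP; first exact: expi_norm.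
apply/eqP; rewrite aE => ta; apply: tN.
have [le_at|/ltW le_ta] := leP alpha t.
  have := expi_eq1_2pi _ (expiB_eq1 ta).
  case; first by rewrite subr_ge0 le_at lerBlDr (le_trans t2)// lerDl.
    by move=> /eqP; rewrite subr_eq0 => /eqP; left; right.
  by move=> tE; right; rewrite -tE addrC subrK.
have := expi_eq1_2pi _ (expiB_eq1 (esym ta)).
case; first by rewrite subr_ge0 le_ta lerBlDr (le_trans alpha2)// lerDl.
  by move=> /eqP; rewrite subr_eq0 => /eqP; left; right.
by move=> tE; left; left; rewrite -tE opprB addrC subrK.
Qed.

Lemma cvg_radial (R : realType) (f : R[i] -> R[i]) (w : R[i]) : normc w = 1 ->
  {for w, continuous f} -> (fun r : R => f (r%:C%C * w)) @ 1^'- --> f w.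
Proof.
move=> w1 fw; apply/cvg_normcP => e e0.
have /(cvg_normcP (nbhs_filter w))/(_ _ e0)/nbhs_ballP[d /gt0_complexE[d0 dE] h] := fw.
near=> r; apply: h.
rewrite -ball_normE /ball_/= dE normrE_normc ltcR -{1}[w]mul1r -mulrBl.
rewrite -[X in X - _]/(1%:C%C) -rmorphB normcM w1 mulr1 normc_real.
near: r; have /cvgrPdist_lt/(_ _ d0) : (fun r : R => r) @ (1 : R)^'- --> (1 : R).
  by apply: cvg_at_left_filter; exact: cvg_id.
exact.
Unshelve. all: by end_near. Qed.

Lemma hardy_mean_ge0 (R : realType) (p : R) (f : R[i] -> R[i]) :
  (0 <= hardy_mean p f)%E.
Proof.
apply: (@le_trans _ _ (integral_mean p f 2^-1)); last first.
  apply: ereal_sup_ubound; exists 2^-1 => //=.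
  by rewrite in_itv/= invr_gt0 ltr0n invf_lt1// ltr1n.
rewrite /integral_mean /circle_integral mule_ge0//.
  by rewrite lee_fin invr_ge0 (ltW pi2_gt0).
by apply: integral_ge0 => t _; rewrite lee_fin powR_ge0.
Qed.

Theorem proposition3p4 (R : realType) (a : R[i]) (ha : normc a = 1)
    (Omega : set R[i]) (Omega_open : open Omega)
    (Omega_nbhd : [set z : R[i] | normc z <= 1] `\ a `<=` Omega)
    (phi : R[i] -> R[i]) (phi_analytic : analytic_on Omega phi)
    (phi_disc : forall z : R[i], disc z -> disc (phi z)) :
  (exists psi : R[i] -> R[i], analytic_on disc psi /\
     exists (p : R) (p1 : 1 <= p) (T : {linear hardy p1 -> hardy p1}),
       weighted_composition phi psi T /\ similar_to_isometry T) ->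
  inner phi.
Proof.
move=> [psi [psian [p [p1 [T [TE Tsim]]]]]].
have phi_at w : normc w <= 1 -> w != a -> analytic_at phi w.
  by move=> w1 /eqP wa; apply: phi_analytic; exact: Omega_nbhd.
have phidan : analytic_on disc phi.
  move=> z z1; apply: phi_at; first exact: ltW.
  by apply: contraTneq z1 => ->; rewrite /disc /mkset ha ltxx.
have phi_circle w : normc w = 1 -> w != a -> analytic_at phi w.
  by move=> w1; apply: phi_at; rewrite w1.
have phic w : normc w = 1 -> w != a -> {for w, continuous phi}.
  by move=> w1 wa; apply: analytic_continuous; exact: phi_circle.
have [uni|iso] := unimodular_alternative ha phi_circle.
  split=> //; apply: (ae_circle_neq ha) => w w1 wa.
  exists (phi w); split; last exact: uni.
  by apply: cvg_radial => //; exact: phic.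
exfalso.
have [C C0 TC] := similar_to_isometry_bounded_below Tsim.
have p0 : 0 < p by rewrite (lt_le_trans ltr01).
have phid := analytic_on_locally_expands phidan.
have psid := analytic_on_locally_expands psian.
have Tz k z : disc z -> T (hardy_monomial k) z = psi z * phi z ^+ k.
  by move=> zd; rewrite TE// /= /monomial (phi_disc z zd : normc (phi z) < 1).
have meanT k r : 0 <= r < 1 ->
    mean p (T (hardy_monomial k)) r = mean p (fun z => psi z * phi z ^+ k) r.
  move=> /andP[r0 r1]; rewrite /mean; congr circ; apply/funext => t.
  by rewrite Tz// /disc /mkset normcM normc_real expi_norm mulr1 ger0_norm.
(* On the disc T maps the constant 1 to psi, so psi inherits bounded means although it is only
   assumed analytic. *)
have [A AT] := hardy_mean_bound (T (hardy_monomial 0)).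
have psiA r : 0 <= r < 1 -> mean p psi r <= A.
  move=> r01; apply: le_trans (AT r r01); rewrite meanT// le_eqVlt; apply/orP; left.
  by apply/eqP; congr mean; apply/funext => z; rewrite expr0 mulr1.
(* Chosen so that C^p g <= 1/4, while the lower bound on T requires C^p g >= 1/2. The 2 pi in [g0]
   appears because [mean] is not normalised. *)
pose g := (4 * (C `^ p + 1))^-1.
have Cp : 0 < C `^ p + 1 by rewrite ltr_wpDl// powR_ge0.
have g0 : 0 < 2 * pi * g by rewrite mulr_gt0 ?pi2_gt0// invr_gt0 mulr_gt0.
have [k [rho [rho01 H]]] :=
  mean_mulX_small p1 psid psiA phid phi_disc ha phic iso g0.
have [Tan _ _] := (hardy_predP p1 _).1 (hardyP (T (hardy_monomial k))).
have : (hardy_mean p (T (hardy_monomial k)) <= g%:E)%E.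
  have -> : g = (2 * pi)^-1 * (2 * pi * g).
    by rewrite mulrA mulVf ?mul1r// gt_eqF// pi2_gt0.
  apply: (hardy_mean_le (rho := rho)) => //.
    exact: analytic_on_locally_expands.
  move=> r rr; rewrite meanT; first exact: H.
  by move: rr rho01 => /andP[rr ->] /andP[rho0 _]; rewrite (le_trans rho0)// ltW.
(* [hardy_norm] passes through [fine], which sends infinity to 0; the bounds on both means make them
   finite before their p-th roots are compared. *)
have := hardy_mean_monomial_ge (p1 := p1) k.
have := hardy_mean_monomial_le (p1 := p1) k.
have := hardy_mean_ge0 p (T (hardy_monomial k)).
have := TC (hardy_monomial k); rewrite /hardy_norm /=.
case: (hardy_mean p (monomial k)) => [x|//|//].
case: (hardy_mean p (T (hardy_monomial k))) => [y|//|//].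
rewrite /= !lee_fin => xy y0 _ x2 yg.
have : x <= C `^ p * y.
  have pV (u : R) : 0 <= u -> (u `^ p^-1) `^ p = u.
    by move=> u0; rewrite -powRrM mulVf ?gt_eqF// powRr1.
  have x0 : 0 <= x by apply: le_trans x2; rewrite invr_ge0.
  rewrite -{1}(pV x x0) -(pV y y0) -powRM ?powR_ge0//.
  by apply: ge0_ler_powR; rewrite ?nnegrE ?mulr_ge0 ?powR_ge0 ?(ltW p0).
move=> /(le_trans x2) h.
have : 2^-1 <= (C `^ p + 1) * g.
  apply: le_trans h _; rewrite ler_pM ?powR_ge0//.
  by rewrite lerDl.
rewrite /g invfM mulrCA divff ?gt_eqF// mulr1 lef_pV2 ?posrE//.
by rewrite ler_nat.
Qed.
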